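(* For every $n\ge 1$ one has $S_n(u,v)=C_n=\frac{1}{n+1}\binom{2n}{n}$ for each of the following pairs of patterns $(u,v)$: (1) $(0001,1012)$, (2) $(0010,0021)$, (3) $(0011,0021)$, (4) $(0021,0121)$, (5) $(0121,0132)$, (6) $(0121,1032)$, (7) $(0122,0132)$, (8) $(0122,1032)$. Moreover, for the pairs (4)–(8), one has $S_{n,m}(u,v)=N_{n,m+1}$ for all $0\le m<n$.
   Context: An ascent in a sequence $x_1\cdots x_k$ is an index $j$ with $x_j<x_{j+1}$; $\mathrm{asc}(x_1\cdots x_k)$ denotes the number of ascents. An ascent sequence of length $n$ is a sequence $x_1x_2\cdots x_n$ of non-negative integers with $x_1=0$ and $x_i\le \mathrm{asc}(x_1\cdots x_{i-1})+1$ for $1<i\le n$. A pattern is a finite sequence $\tau=\tau_1\cdots\tau_k$ of non-negative integers (repetitions allowed). A sequence $\pi$ contains $\tau$ if it has a subsequence $\pi_{f(1)}\cdots\pi_{f(k)}$ ($f(1)<\dots<f(k)$) order-isomorphic to $\tau$, i.e. $\pi_{f(i)}<\pi_{f(j)}$ iff $\tau_i<\tau_j$ and $\pi_{f(i)}>\pi_{f(j)}$ iff $\tau_i>\tau_j$ (so equal letters of $\tau$ correspond to equal letters); otherwise $\pi$ avoids $\tau$. For a set of patterns $T$, $\mathcal{S}_n(T)$ is the set of ascent sequences of length $n$ avoiding every pattern in $T$, $S_n(T)=|\mathcal{S}_n(T)|$; for $0\le m<n$, $\mathcal{S}_{n,m}(T)$ is the subset of those with exactly $m$ ascents and $S_{n,m}(T)$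 its cardinality. We write $S_n(u,v)$ for $S_n(\{u,v\})$, etc. $C_n=\frac1{n+1}\binom{2n}{n}$ is the Catalan number and $N_{n,m}=\frac1n\binom{n}{m}\binom{n}{m-1}$ ($1\le m\le n$) is the Narayana number. *)

(* Defs.v *)
From mathcomp Require Import all_boot.
Set Implicit Arguments. Unset Strict Implicit. Unset Printing Implicit Defensive.

Definition asc (s : seq nat) : nat :=
  count (fun p : nat * nat => p.1 < p.2) (zip s (behead s)).

Definition is_ascent_seq (s : seq nat) : bool :=
  (nth 0 s 0 == 0) &&
  all (fun i => nth 0 s i <= (asc (take i s)).+1) (iota 1 (size s).-1).

Definition order_iso (t tau : seq nat) : bool :=
  (size t == size tau) &&
  all (fun i => all (fun j =>
      ((nth 0 t i < nth 0 t j) == (nth 0 tau i < nth 0 tau j)) &&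
      ((nth 0 t i > nth 0 t j) == (nth 0 tau i > nth 0 tau j)))
    (iota 0 (size tau))) (iota 0 (size tau)).

Definition contains (pi tau : seq nat) : bool :=
  [exists m : (size pi).-tuple bool, order_iso (mask m pi) tau].

Definition avoids_all (T : seq (seq nat)) (pi : seq nat) : bool :=
  all (fun tau => ~~ contains pi tau) T.

(* Every ascent sequence of length n has entries < n, so ascent sequences of
   length n are exactly the tuples over 'I_n satisfying is_ascent_seq. *)
Definition S_n (T : seq (seq nat)) (n : nat) : nat :=
  #|[set t : n.-tuple 'I_n |
      is_ascent_seq (map val t) && avoids_all T (map val t)]|.

Definition S_nm (T : seq (seq nat)) (n m : nat) : nat :=
  #|[set t : n.-tuple 'I_n |
      [&& is_ascent_seq (map val t), avoids_all T (map val t)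
        & asc (map val t) == m]]|.

Definition catalan (n : nat) : nat := 'C(n.*2, n) %/ n.+1.

(* N_{n,m} = (1/n) C(n,m) C(n,m-1), for 1 <= m <= n (an integer) *)
Definition narayana (n m : nat) : nat := ('C(n, m) * 'C(n, m.-1)) %/ n.

(* Main.v *)
(** Each class is described by a generating tree.

    Pairs (4)-(8).  For (4), (5), (6) the avoiding ascent sequences are those whose
    positive letters weakly increase, for (7), (8) those whose letters [> 1] strictly
    increase.  Appending letters gives the same tree in both cases: with [D i], [U i]
    for a last letter zero, resp. nonzero, the children are
      [D i -> D i, U 0, .., U i]   and   [U i -> D (i+1), U i, U 0, .., U i],
    where the final block [U 0, .., U i] creates an ascent (weight [z]).  If [t] marks
    length and [H] is the generating function of Motzkin paths with levels weighted
    [1 + z] and up steps [z], then the generating function below [D i] is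
    [(1 - t)^i H^(i+1)], so the root gives [H], whose coefficients are Narayana numbers
    by the reflection principle.

    Pairs (2), (3).  Once a letter [a] is repeated and then followed by [c > a], the
    letters of [[a, c)], resp. of [(a, c]], are forbidden.  The number [M + 2] of letters
    which can be appended and the smallest repeated letter [x] determine the subtree, and
    the number of sequences of length [n] labelled [(M, x)] is the ballot number
    [[t^(n-M-2)] C(t)^(M-x+2)].

    Pair (1).  Call a word free if it has no subsequence [y a y] with [a <= y]; then the
    class consists of the restricted growth functions in which such a subsequence is
    followed only by letters [<= y].  Here letters are inserted rather than
    appended: a new maximum, or another copy of the maximum that becomes the first
    obstruction to freeness (or is adjacent to its only copy).  If [a] letters lie between
    the first maximum and the end of the free prefix, the label [2a + 2] or [2a + 1],
    according to whether the maximum occurs once or not, satisfies the Catalan rule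
    [l -> 2, 3, .., l + 1]. *)

Require Import Defs.
From mathcomp Require Import all_boot all_algebra.
From mathcomp Require Import zify ring.
Set Implicit Arguments. Unset Strict Implicit. Unset Printing Implicit Defensive.

(** * Ascent sequences *)

Lemma asc_rcons w x : w != [::] -> asc (rcons w x) = asc w + (last 0 w < x).
Proof.
case: w => [//|a w] _; rewrite /asc /=; elim: w a => [|b w IH] a /=.
  by rewrite addn0.
by rewrite IH addnA.
Qed.

Lemma is_ascent_seq_rcons w x : w != [::] ->
  is_ascent_seq (rcons w x) = is_ascent_seq w && (x <= (asc w).+1).
Proof.
move=> w0; rewrite /is_ascent_seq nth_rcons.
have sw : 0 < size w by case: w w0.
rewrite sw size_rcons /= -andbA; congr (_ && _).
have -> : iota 1 (size w) = iota 1 (size w).-1 ++ [:: size w].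
  by case: (size w) sw => // k _; rewrite -{1}[k.+1]addn1 iotaD.
rewrite all_cat /= andbT.
rewrite nth_rcons ltnn eqxx -cats1 take_size_cat //; congr (_ && _).
apply: eq_in_all => i; rewrite mem_iota add1n prednK // => /andP[i0 iw].
by rewrite nth_cat iw takel_cat // ltnW.
Qed.

Lemma is_ascent_seq1 x : is_ascent_seq [:: x] = (x == 0).
Proof. by rewrite /is_ascent_seq /= andbT. Qed.

Lemma is_ascent_seq_cat u v : is_ascent_seq (u ++ v) -> is_ascent_seq u.
Proof.
elim/last_ind: v => [|v x IH]; rewrite ?cats0 // -rcons_cat.
case: (altP (u ++ v =P [::])) => [|n0]; first by case: u IH.
by rewrite is_ascent_seq_rcons // => /andP[/IH].
Qed.

(** A letter can reach [(asc w).+1] only by exceeding the last letter, which is at most [asc w] by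
    induction; it then creates the ascent that raises the bound. *)
Lemma ascent_seq_le_asc w y : is_ascent_seq w -> y \in w -> y <= asc w.
Proof.
elim/last_ind: w y => [//|w x IH] y.
case: (altP (w =P [::])) => [->|w0].
  by rewrite is_ascent_seq1 inE => /eqP -> /eqP ->.
rewrite is_ascent_seq_rcons // asc_rcons // mem_rcons inE => /andP[aw xle].
have lw : last 0 w \in w by case: (w) w0 => //= a l _; apply: mem_last.
case/predU1P => [->|/(IH _ aw)]; last by lia.
by have := IH _ aw lw; lia.
Qed.

Lemma last_le_asc w : is_ascent_seq w -> last 0 w <= asc w.
Proof.
by case: w => // a v aw; apply: ascent_seq_le_asc aw _; apply: mem_last.
Qed.

Lemma asc_lt_size w : w != [::] -> asc w < size w.
Proof.
elim/last_ind: w => [//|w x IH] _; case: (altP (w =P [::])) => [->//|w0].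
by rewrite asc_rcons // size_rcons; have := IH w0; lia.
Qed.

Lemma ascent_seq_head w : is_ascent_seq w -> w != [::] -> w = 0 :: behead w.
Proof. by case: w => //= x w; rewrite /is_ascent_seq /= => /andP[/eqP -> _]. Qed.

(** * Pattern containment *)

Lemma containsP pi tau :
  reflect (exists2 t, subseq t pi & order_iso t tau) (contains pi tau).
Proof.
apply: (iffP existsP) => [[m iso]|[t /subseqP[m sz ->] iso]].
  by exists (mask m pi); rewrite ?mask_subseq.
by exists (tcast sz (in_tuple m)); rewrite val_tcast.
Qed.

Lemma order_iso_lt t tau i j : order_iso t tau ->
  i < size tau -> j < size tau ->
  (nth 0 t i < nth 0 t j) = (nth 0 tau i < nth 0 tau j).
Proof.
case/andP=> _ /allP H itau jtau.
have /H /allP /(_ j) : i \in iota 0 (size tau) by rewrite mem_iota.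
by rewrite mem_iota => /(_ jtau) /andP[/eqP].
Qed.

Lemma order_iso4 t i j k l : order_iso t [:: i; j; k; l] ->
  exists a b c d, t = [:: a; b; c; d] /\
   [/\ [/\ (a < b) = (i < j), (a < c) = (i < k) & (a < d) = (i < l)],
    [/\ (b < a) = (j < i), (b < c) = (j < k) & (b < d) = (j < l)],
    [/\ (c < a) = (k < i), (c < b) = (k < j) & (c < d) = (k < l)] &
    [/\ (d < a) = (l < i), (d < b) = (l < j) & (d < c) = (l < k)]].
Proof.
move=> iso; have := iso; case/andP=> + _.
case: t iso => [|a [|b [|c [|d [|e t]]]]] // iso _.
exists a, b, c, d; split=> //; have H := order_iso_lt iso.
split; split.
- exact: (H 0 1).
- exact: (H 0 2).
- exact: (H 0 3).
- exact: (H 1 0).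
- exact: (H 1 2).
- exact: (H 1 3).
- exact: (H 2 0).
- exact: (H 2 1).
- exact: (H 2 3).
- exact: (H 3 0).
- exact: (H 3 1).
- exact: (H 3 2).
Qed.

Ltac pattern_order :=
  rewrite /order_iso /= ?ltnn ?eqxx;
  repeat (match goal with |- context [?x < ?y] =>
    let H := fresh in
    first [have H : (x < y) = true by lia | have H : (x < y) = false by lia];
    rewrite H {H} end).

Lemma contains_0001P w :
  reflect (exists a b, a < b /\ subseq [:: a; a; a; b] w)
          (contains w [:: 0; 0; 0; 1]).
Proof.
apply: (iffP (containsP _ _)) => [[t + iso]|].
  have [a [b [c [d [-> [[h1 h2 h3] [h4 h5 h6] [h7 h8 h9] [h10 h11 h12]]]]]]] :=
    order_iso4 iso.
  move=> sub; exists a, d; split; first lia.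
  have ba : b = a by lia.
  have ca : c = a by lia.
  by move: sub; rewrite ?ba ?ca.
case=> a [b [lts sub]]; exists [:: a; a; a; b] => //.
by pattern_order.
Qed.

Lemma contains_1012P w :
  reflect (exists a b c, (a < b < c) /\ subseq [:: b; a; b; c] w)
          (contains w [:: 1; 0; 1; 2]).
Proof.
apply: (iffP (containsP _ _)) => [[t + iso]|].
  have [a [b [c [d [-> [[h1 h2 h3] [h4 h5 h6] [h7 h8 h9] [h10 h11 h12]]]]]]] :=
    order_iso4 iso.
  move=> sub; exists b, a, d; split; first lia.
  have ca : c = a by lia.
  by move: sub; rewrite ?ca.
case=> a [b [c [lts sub]]]; exists [:: b; a; b; c] => //.
by pattern_order.
Qed.

Lemma contains_0010P w :
  reflect (exists a b, a < b /\ subseq [:: a; a; b; a] w)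
          (contains w [:: 0; 0; 1; 0]).
Proof.
apply: (iffP (containsP _ _)) => [[t + iso]|].
  have [a [b [c [d [-> [[h1 h2 h3] [h4 h5 h6] [h7 h8 h9] [h10 h11 h12]]]]]]] :=
    order_iso4 iso.
  move=> sub; exists a, c; split; first lia.
  have ba : b = a by lia.
  have da : d = a by lia.
  by move: sub; rewrite ?ba ?da.
case=> a [b [lts sub]]; exists [:: a; a; b; a] => //.
by pattern_order.
Qed.

Lemma contains_0021P w :
  reflect (exists a b c, (a < b < c) /\ subseq [:: a; a; c; b] w)
          (contains w [:: 0; 0; 2; 1]).
Proof.
apply: (iffP (containsP _ _)) => [[t + iso]|].
  have [a [b [c [d [-> [[h1 h2 h3] [h4 h5 h6] [h7 h8 h9] [h10 h11 h12]]]]]]] :=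
    order_iso4 iso.
  move=> sub; exists a, d, c; split; first lia.
  have ba : b = a by lia.
  by move: sub; rewrite ?ba.
case=> a [b [c [lts sub]]]; exists [:: a; a; c; b] => //.
by pattern_order.
Qed.

Lemma contains_0011P w :
  reflect (exists a b, a < b /\ subseq [:: a; a; b; b] w)
          (contains w [:: 0; 0; 1; 1]).
Proof.
apply: (iffP (containsP _ _)) => [[t + iso]|].
  have [a [b [c [d [-> [[h1 h2 h3] [h4 h5 h6] [h7 h8 h9] [h10 h11 h12]]]]]]] :=
    order_iso4 iso.
  move=> sub; exists a, c; split; first lia.
  have ba : b = a by lia.
  have dc : d = c by lia.
  by move: sub; rewrite ?ba ?dc.
case=> a [b [lts sub]]; exists [:: a; a; b; b] => //.
by pattern_order.
Qed.

Lemma contains_0121P w :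
  reflect (exists a b c, (a < b < c) /\ subseq [:: a; b; c; b] w)
          (contains w [:: 0; 1; 2; 1]).
Proof.
apply: (iffP (containsP _ _)) => [[t + iso]|].
  have [a [b [c [d [-> [[h1 h2 h3] [h4 h5 h6] [h7 h8 h9] [h10 h11 h12]]]]]]] :=
    order_iso4 iso.
  move=> sub; exists a, b, c; split; first lia.
  have db : d = b by lia.
  by move: sub; rewrite ?db.
case=> a [b [c [lts sub]]]; exists [:: a; b; c; b] => //.
by pattern_order.
Qed.

Lemma contains_0132P w :
  reflect (exists a b c d, [&& a < b, b < c & c < d] /\ subseq [:: a; b; d; c] w)
          (contains w [:: 0; 1; 3; 2]).
Proof.
apply: (iffP (containsP _ _)) => [[t + iso]|].
  have [a [b [c [d [-> [[h1 h2 h3] [h4 h5 h6] [h7 h8 h9] [h10 h11 h12]]]]]]] :=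
    order_iso4 iso.
  move=> sub; exists a, b, d, c; split; first lia.
  exact: sub.
case=> a [b [c [d [lts sub]]]]; exists [:: a; b; d; c] => //.
by pattern_order.
Qed.

Lemma contains_1032P w :
  reflect (exists a b c d, [&& a < b, b < c & c < d] /\ subseq [:: b; a; d; c] w)
          (contains w [:: 1; 0; 3; 2]).
Proof.
apply: (iffP (containsP _ _)) => [[t + iso]|].
  have [a [b [c [d [-> [[h1 h2 h3] [h4 h5 h6] [h7 h8 h9] [h10 h11 h12]]]]]]] :=
    order_iso4 iso.
  move=> sub; exists b, a, d, c; split; first lia.
  exact: sub.
case=> a [b [c [d [lts sub]]]]; exists [:: b; a; d; c] => //.
by pattern_order.
Qed.

Lemma contains_0122P w :
  reflect (exists a b c, (a < b < c) /\ subseq [:: a; b; c; c] w)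
          (contains w [:: 0; 1; 2; 2]).
Proof.
apply: (iffP (containsP _ _)) => [[t + iso]|].
  have [a [b [c [d [-> [[h1 h2 h3] [h4 h5 h6] [h7 h8 h9] [h10 h11 h12]]]]]]] :=
    order_iso4 iso.
  move=> sub; exists a, b, c; split; first lia.
  have dc : d = c by lia.
  by move: sub; rewrite ?dc.
case=> a [b [c [lts sub]]]; exists [:: a; b; c; c] => //.
by pattern_order.
Qed.

(** * Subsequences *)

Lemma subseq_rcons_rcons (T : eqType) (s w : seq T) a x :
  subseq (rcons s a) (rcons w x) =
  if a == x then subseq s w else subseq (rcons s a) w.
Proof.
have := subseq_rev (rcons s a) (rcons w x); rewrite !rev_rcons /= => <-.
by case: ifP => _; rewrite -?rev_rcons subseq_rev.
Qed.

Lemma subseq_pair (T : eqType) (w : seq T) x y : x != y -> x \in w -> y \in w ->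
  subseq [:: x; y] w || subseq [:: y; x] w.
Proof.
move=> xy /splitPr[p r]; rewrite mem_cat inE eq_sym (negbTE xy) /= => /orP[yp|yr].
  by apply/orP; right; apply: (@cat_subseq _ [:: y] [:: x]); rewrite sub1seq ?mem_head.
apply/orP; left; apply: subseq_trans (suffix_subseq _ _).
by rewrite /= eqxx sub1seq.
Qed.

Lemma first_occurrence (T : eqType) (w : seq T) x : x \in w ->
  exists p r, w = p ++ x :: r /\ x \notin p.
Proof.
move=> xw; exists (take (index x w) w), (drop (index x w).+1 w).
rewrite -{2}(nth_index x xw) -drop_nth ?index_mem // cat_take_drop.
by rewrite in_take // ltnn.
Qed.

Lemma subseq_zero_cons s w : is_ascent_seq w -> s != [::] -> 0 \notin s ->
  subseq s w -> subseq (0 :: s) w.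
Proof.
case: s => // x s aw _; rewrite inE negb_or => /andP[x0 _].
have [->//|w0] := eqVneq w [::].
by rewrite (ascent_seq_head aw w0) /= eq_sym (negbTE x0).
Qed.

Lemma avoids_all_subseq T w w' : subseq w w' -> avoids_all T w' -> avoids_all T w.
Proof.
move=> sub /allP av; apply/allP => tau /av; apply: contraNN.
by case/containsP=> t tw iso; apply/containsP; exists t; rewrite ?(subseq_trans tw).
Qed.

Lemma avoids_pair u v w : avoids_all [:: u; v] w = ~~ contains w u && ~~ contains w v.
Proof. by rewrite /avoids_all /= andbT. Qed.

(** * Enumeration by generating trees *)

(** Moves the count from tuples over ['I_n] to any duplicate-free list of words. Every word of the
    list lifts to a tuple because its letters are at most [asc w < n]. *)
Lemma card_ascent_tuples (Q : pred (seq nat)) n (L : seq (seq nat)) : uniq L ->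
  (forall w, (w \in L) = [&& size w == n, is_ascent_seq w & Q w]) ->
  #|[set t : n.-tuple 'I_n | is_ascent_seq (map val t) && Q (map val t)]| = size L.
Proof.
move=> uL memL; rewrite cardE -(size_map (fun t : n.-tuple 'I_n => map val t)).
apply/perm_size/uniq_perm => //.
  rewrite map_inj_uniq ?enum_uniq // => t u /(inj_map val_inj) tu.
  exact: val_inj.
move=> w; rewrite memL; apply/mapP/idP => [[t]|].
  rewrite mem_enum inE => aQw ->.
  by rewrite size_map size_tuple eqxx.
case/and3P=> /eqP szw aw Qw.
have wn : all (fun x => x < n) w.
  apply/allP => x xw; apply: leq_ltn_trans (ascent_seq_le_asc aw xw) _.
  by rewrite -szw asc_lt_size //; case: (w) xw.
have [s sw] : exists s : seq 'I_n, w = map val s.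
  elim: w wn {szw aw Qw} => [|x w IH] /=; first by exists [::].
  by case/andP=> xn /IH[s ->]; exists (Ordinal xn :: s).
have szs : size s == n by rewrite -(size_map val) -sw; apply/eqP.
by exists (Tuple szs); rewrite ?mem_enum ?inE /= -?sw ?aw ?Qw.
Qed.

Lemma S_n_eq_size T n (L : seq (seq nat)) : uniq L ->
  (forall w, (w \in L) = [&& size w == n, is_ascent_seq w & avoids_all T w]) ->
  S_n T n = size L.
Proof. exact: card_ascent_tuples. Qed.

Lemma S_nm_eq_count T n m (L : seq (seq nat)) : uniq L ->
  (forall w, (w \in L) = [&& size w == n, is_ascent_seq w & avoids_all T w]) ->
  S_nm T n m = count (fun w => asc w == m) L.
Proof.
move=> uL memL; rewrite -size_filter.
apply: (@card_ascent_tuples (fun w => avoids_all T w && (asc w == m))).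
  by rewrite filter_uniq.
by move=> w; rewrite mem_filter memL andbC -!andbA.
Qed.

Section GeneratingTree.
Variables (X : eqType) (ch : X -> seq X).

Definition level k (s : seq X) := iter k (fun s => flatten (map ch s)) s.

Lemma levelS k s : level k.+1 s = flatten (map ch (level k s)).
Proof. by []. Qed.

Lemma levelSr k s : level k.+1 s = level k (flatten (map ch s)).
Proof. by rewrite /level iterSr. Qed.

Lemma level_cat k s t : level k (s ++ t) = level k s ++ level k t.
Proof. by elim: k => //= k IH; rewrite IH map_cat flatten_cat. Qed.

Lemma level_flatten k s : level k s = flatten [seq level k [:: x] | x <- s].
Proof.
elim: s => [|x s IH] /=; first by elim: k => //= k ->.
by rewrite -IH -level_cat.
Qed.

Lemma uniq_flatten_children s : uniq s -> {in s, forall x, uniq (ch x)} ->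
  {in s &, forall x y z, z \in ch x -> z \in ch y -> x = y} ->
  uniq (flatten (map ch s)).
Proof.
elim: s => //= x s IH /andP[xs us] uch inj.
have uF : uniq (flatten (map ch s)).
  apply: IH => // [y ys|y z ys zs]; first by apply: uch; rewrite inE ys orbT.
  by apply: inj; rewrite inE (ys, zs) orbT.
rewrite cat_uniq uch ?mem_head //= uF andbT.
apply/hasPn => z /flatten_mapP[y ys zy]; apply/negP => zx.
by move: xs; rewrite (inj x y _ _ z) ?mem_head ?ys // inE ys orbT.
Qed.

End GeneratingTree.

(** Labels may forget most of a word: once the label determines the labels of the children, in
    order, generations of words can be replaced by generations of labels. [P] confines the
    hypothesis to nodes that can be reached. *)
Lemma level_morph (X Y : eqType) (chX : X -> seq X) (chY : Y -> seq Y)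
    (f : X -> Y) (P : X -> Prop) :
  (forall x, P x -> map f (chX x) = chY (f x)) ->
  (forall x y, P x -> y \in chX x -> P y) ->
  forall k s, (forall x, x \in s -> P x) ->
  map f (level chX k s) = level chY k (map f s).
Proof.
move=> fch Pch; elim=> // k IH s Ps; rewrite !levelSr IH; last first.
  by move=> y /flatten_mapP[x xs]; apply: Pch; apply: Ps.
congr level; rewrite map_flatten -!map_comp; congr flatten.
by apply/eq_in_map => x xs; apply/fch/Ps.
Qed.

Section AppendTree.
Variables (K : pred (seq nat)) (allowed : seq nat -> seq nat).
Hypothesis K1 : forall x, K [:: x] = (x == 0).
Hypothesis K_prefix : forall w x, w != [::] -> K (rcons w x) -> K w.
Hypothesis allowedE : forall w x, w != [::] -> K w ->
  (x \in allowed w) = K (rcons w x).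
Hypothesis allowed_uniq : forall w, w != [::] -> K w -> uniq (allowed w).

Definition append_children w := map (rcons w) (allowed w).

Lemma mem_append_level k w :
  (w \in level append_children k [:: [:: 0]]) = (size w == k.+1) && K w.
Proof.
elim: k w => [|k IH] w.
  rewrite inE; apply/eqP/andP => [->|[]]; first by rewrite K1.
  by case: w => [|x []] // _; rewrite K1 => /eqP ->.
rewrite levelS; apply/flatten_mapP/andP => [[u]|[]].
  rewrite IH => /andP[szu Ku] /mapP[x].
  have u0 : u != [::] by case: (u) szu.
  by rewrite allowedE // => Kux ->; rewrite size_rcons (eqP szu).
case/lastP: w => // u x; rewrite size_rcons eqSS => szu Kux.
have u0 : u != [::] by case: (u) szu.
have Ku := K_prefix u0 Kux.
by exists u; rewrite ?IH ?szu // mem_map ?allowedE //; apply: rcons_injr.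
Qed.

Lemma append_level_uniq k : uniq (level append_children k [:: [:: 0]]).
Proof.
elim: k => // k IH; rewrite levelS; apply: uniq_flatten_children => // [u|u v].
  rewrite mem_append_level => /andP[szu Ku].
  have u0 : u != [::] by case: (u) szu.
  by rewrite map_inj_uniq ?allowed_uniq //; apply: rcons_injr.
by move=> _ _ _ /mapP[x _ ->] /mapP[y _ /rcons_inj[]].
Qed.

End AppendTree.

(** * Ballot numbers *)

(* The coefficient of [x ^ k] in the [l]-th power of the Catalan series. *)
Fixpoint ballot k l := if k is k'.+1 then \sum_(i < l) ballot k' i.+2 else 1.

Lemma ballotS k l : ballot k.+1 l.+1 = ballot k.+1 l + ballot k l.+2.
Proof. exact: big_ord_recr. Qed.

Lemma ballotS0 k : ballot k.+1 0 = 0.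
Proof. exact: big_ord0. Qed.

(** The reflection formula, with the subtracted binomial moved to the left to stay in [nat]. For
    [l = 0] the two binomials agree by symmetry; otherwise Pascal's rule matches [ballotS]. *)
Lemma ballot_bin k l :
  ballot k.+1 l + 'C((k + k + l).+1, k) = 'C((k + k + l).+1, k.+1).
Proof.
elim: k l => [|k IH] l.
  by rewrite /= sum1_card card_ord bin0 bin1 addn1.
elim: l => [|l IHl].
  by rewrite ballotS0 addn0 -[in RHS]bin_sub ?add0n; [congr ('C(_, _)) |]; lia.
have := IH l.+2; rewrite (ballotS k.+1).
rewrite (_ : (k + k + l.+2).+1 = (k.+1 + k.+1 + l).+1); last by lia.
rewrite (_ : (k.+1 + k.+1 + l.+1).+1 = (k.+1 + k.+1 + l).+2); last by lia.
by move: IHl; set n := (k.+1 + k.+1 + l).+1; rewrite (binS n) (binS n); lia.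
Qed.

(** The coefficient form of [C = 1 + x C^2] for the Catalan series [C]. *)
Lemma ballot_catalan k : ballot k 2 = catalan k.+1.
Proof.
case: k => // k; rewrite /catalan.
have := ballot_bin k 2; set n := (k + k + 2).+1 => E.
(* [catalan] is a truncated quotient, so the central binomial is first shown to be an exact multiple
   of the divisor. *)
have -> : 'C(k.+2.*2, k.+2) = ballot k.+1 2 * k.+3; last by rewrite mulnK.
have b1 := mul_bin_left n k; have b2 := mul_bin_left n k.+1.
have -> : k.+2.*2 = n.+1 by rewrite /n; lia.
rewrite binS; move: E b1 b2.
rewrite (_ : n - k = k.+3) 1?(_ : n - k.+1 = k.+2); try by rewrite /n; lia.
move: 'C(n, k) 'C(n, k.+1) 'C(n, k.+2) (ballot _ _) => a b c s; nia.
Qed.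

(** * The classes with Narayana distribution *)

Definition pos_incr (w : seq nat) := pairwise leq [seq y <- w | 0 < y].
Definition gt1_strict (w : seq nat) := pairwise ltn [seq y <- w | 1 < y].

Lemma pos_incr_rcons w x :
  pos_incr (rcons w x) = pos_incr w && ((x == 0) || all (fun y => y <= x) w).
Proof.
rewrite /pos_incr filter_rcons; case: x => [|x] /=; first by rewrite andbT.
rewrite pairwise_rcons andbC; congr (_ && _); rewrite all_filter.
by apply: eq_all => -[|y].
Qed.

Lemma gt1_strict_rcons w x :
  gt1_strict (rcons w x) = gt1_strict w && ((x <= 1) || all (fun y => y < x) w).
Proof.
rewrite /gt1_strict filter_rcons; case: ltnP => /= x1; last by rewrite andbT.
rewrite pairwise_rcons andbC; congr (_ && _); rewrite all_filter.
by apply: eq_all => y /=; lia.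
Qed.

Lemma pairwise_filter_subseq2 (e : rel nat) (a : pred nat) w c b :
  pairwise e [seq y <- w | a y] -> subseq [:: c; b] w -> a c -> a b -> e c b.
Proof.
move=> pw sub ac ab.
have sub' : subseq [:: c; b] [seq y <- w | a y] by rewrite subseq_filter /= ac ab.
by have := subseq_pairwise sub' pw; rewrite /= !andbT.
Qed.

(** Before the first ascent the bound on a new letter is 1, so the letter that creates this ascent
    can only be 1. *)
Lemma ascent_seq_mem1 w : is_ascent_seq w -> 0 < asc w -> 1 \in w.
Proof.
elim/last_ind: w => // w x IH; have [->//|w0] := eqVneq w [::].
rewrite is_ascent_seq_rcons // asc_rcons // mem_rcons inE => /andP[aw xle].
by case: (posnP (asc w)) => [|/(IH aw) ->]; rewrite ?orbT //; lia.
Qed.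

Lemma sorted_leq_rcons w x : sorted leq (rcons w x) = sorted leq w && (last 0 w <= x).
Proof. by case: w => //= a w; rewrite rcons_path. Qed.

(** As long as the word weakly increases, [asc] equals the last letter, so the next letter repeats
    it or is its successor and no value is skipped. *)
Lemma sorted_ascent_seq w : is_ascent_seq w -> w != [::] -> sorted leq w ->
  asc w = last 0 w /\ subseq (iota 0 (last 0 w).+1) w.
Proof.
elim/last_ind: w => // w x IH; have [->|w0] := eqVneq w [::].
  by rewrite is_ascent_seq1 => /eqP ->.
rewrite is_ascent_seq_rcons // asc_rcons // last_rcons sorted_leq_rcons.
move=> /andP[aw xle] _ /andP[sw lx].
have [ascw sub] := IH aw w0 sw.
have [lt|ge] := ltnP (last 0 w) x.
  split; first lia.
  have -> : x = (last 0 w).+1 by lia.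
  by rewrite -[in iota _ _]addn1 iotaD -cats1; apply: cat_subseq.
have -> : x = last 0 w by lia.
split; first lia.
by apply: subseq_trans sub (subseq_rcons _ _).
Qed.

Lemma subseq_01 w : is_ascent_seq w -> 1 \in w -> subseq [:: 0; 1] w.
Proof. by move=> aw w1; apply: subseq_zero_cons; rewrite ?sub1seq. Qed.

(** The first descent must end in 0, since positive letters weakly increase; up to that point every
    value from 0 to the last letter has occurred, in particular 0 and 1. *)
Lemma pos_incr_descent w : is_ascent_seq w -> pos_incr w -> ~~ sorted leq w ->
  subseq [:: 0; 1; 0] w.
Proof.
elim/last_ind: w => // w x IH; have [->//|w0] := eqVneq w [::].
rewrite is_ascent_seq_rcons // pos_incr_rcons => /andP[aw xle] /andP[pw xw].
rewrite sorted_leq_rcons; have [sw|nsw _] := boolP (sorted leq w); last first.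
  exact: subseq_trans (IH aw pw nsw) (subseq_rcons _ _).
rewrite /= -ltnNge => xl; have [_ sub] := sorted_ascent_seq aw w0 sw.
have -> : x = 0.
  case/predU1P: xw => // /allP /(_ (last 0 w)).
  by rewrite leqNgt xl; case: (w) w0 => // a v _ /(_ (mem_last _ _)).
rewrite -[[:: 0; 1; 0]]/(rcons [:: 0; 1] 0) subseq_rcons_rcons eqxx.
apply: subseq_trans sub; rewrite -[[:: 0; 1]]/(iota 0 2).
by rewrite -(subnKC (_ : 2 <= (last 0 w).+1)) ?iotaD ?prefix_subseq //; lia.
Qed.

(** The first descent must end in 0 or 1, and all values up to the last letter occur before it: a
    descent to 0 leaves [0 1 0], a descent to 1 starts above 1 and leaves [0 1 2 1]. *)
Lemma gt1_strict_descent w : is_ascent_seq w -> gt1_strict w -> ~~ sorted leq w ->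
  subseq [:: 0; 1; 0] w || subseq [:: 0; 1; 2; 1] w.
Proof.
elim/last_ind: w => // w x IH; have [->//|w0] := eqVneq w [::].
rewrite is_ascent_seq_rcons // gt1_strict_rcons => /andP[aw xle] /andP[pw xw].
rewrite sorted_leq_rcons; have [sw|nsw _] := boolP (sorted leq w); last first.
  by case/orP: (IH aw pw nsw) => sub; apply/orP; [left|right];
     apply: subseq_trans sub (subseq_rcons _ _).
rewrite /= -ltnNge => xl; have [_ sub] := sorted_ascent_seq aw w0 sw.
have x1 : x <= 1.
  case/orP: xw => // /allP /(_ (last 0 w)).
  by rewrite ltnNge ltnW //; case: (w) w0 => // a v _ /(_ (mem_last _ _)).
have iota_sub j : j <= last 0 w -> subseq (iota 0 j.+1) w.
  move=> jl; apply: subseq_trans sub.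
  by rewrite -(subnKC (_ : j.+1 <= (last 0 w).+1)) ?iotaD ?prefix_subseq.
case: x x1 xl {xle xw} => [|[|//]] _ xl.
  rewrite -[[:: 0; 1; 0]]/(rcons (iota 0 2) 0) subseq_rcons_rcons eqxx.
  by rewrite iota_sub.
rewrite -[[:: 0; 1; 2; 1]]/(rcons (iota 0 3) 1) subseq_rcons_rcons eqxx.
by rewrite iota_sub ?orbT.
Qed.

(* Before the first [c] there is a descent: a weakly increasing ascent sequence
   contains every letter up to its maximum, in particular [b]. *)
Lemma skipped_letter w b c : is_ascent_seq w -> c \in w -> b \notin w -> b < c ->
  exists p r, [/\ w = p ++ c :: r, is_ascent_seq p & ~~ sorted leq p].
Proof.
move=> aw /first_occurrence[p [r [wE cp]]] bw bc; exists p, r.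
move: aw bw; rewrite wE -cat_rcons => /is_ascent_seq_cat apc.
rewrite mem_cat mem_rcons inE !negb_or => /andP[/andP[_ bp] _].
have [p0|p0] := eqVneq p [::].
  by move: apc; rewrite p0 is_ascent_seq1 => /eqP c0; rewrite c0 in bc.
move: apc; rewrite is_ascent_seq_rcons // => /andP[ap cle]; split=> //.
apply: contra bp => /(sorted_ascent_seq ap p0)[ascp /mem_subseq]; apply.
by rewrite mem_iota; lia.
Qed.

Lemma pos_incr_skipped w b c : is_ascent_seq w -> pos_incr w ->
  c \in w -> b \notin w -> b < c -> subseq [:: 0; 1; 0; c] w.
Proof.
move=> aw pw cw bw bc; have [p [r [wE ap np]]] := skipped_letter aw cw bw bc.
move: pw; rewrite wE /pos_incr filter_cat pairwise_cat => /and3P[_ pp _].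
apply: (@cat_subseq _ [:: 0; 1; 0] [:: c]); first exact: pos_incr_descent.
by rewrite sub1seq mem_head.
Qed.

Lemma gt1_strict_skipped w b c : is_ascent_seq w -> gt1_strict w ->
  c \in w -> b \notin w -> b < c ->
  subseq [:: 0; 1; 0; c] w || subseq [:: 0; 1; 2; 1; c] w.
Proof.
move=> aw pw cw bw bc; have [p [r [wE ap np]]] := skipped_letter aw cw bw bc.
move: pw; rewrite wE /gt1_strict filter_cat pairwise_cat => /and3P[_ pp _].
case/orP: (gt1_strict_descent ap pp np) => sub; apply/orP; [left|right].
  by apply: (@cat_subseq _ [:: 0; 1; 0] [:: c]); rewrite // sub1seq mem_head.
by apply: (@cat_subseq _ [:: 0; 1; 2; 1] [:: c]); rewrite // sub1seq mem_head.
Qed.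

Section PosIncr.
Variable T : seq (seq nat).
Hypothesis avoidT : forall w, pos_incr w -> avoids_all T w.
Hypothesis repeatT : forall w b c, 0 < b < c -> subseq [:: 0; b; c; b] w ->
  ~~ avoids_all T w.
Hypothesis skipT : forall w b c, 1 < b < c -> subseq [:: 0; 1; 0; c; b] w ->
  ~~ avoids_all T w.

(** Suppose a positive [b] is appended after a larger [c]. If [b] occurred before, it did so before
    [c], which gives [0 b c b]. Otherwise [c] skipped [b], so [0 1 0 c] is present, and [b > 1]
    because 1 has occurred. The pairs differ only in the pattern that rules out each
    configuration. *)
Lemma avoids_pos_incr w : is_ascent_seq w -> avoids_all T w = pos_incr w.
Proof.
move=> aw; apply/idP/idP; last exact: avoidT.
elim/last_ind: w aw => // w b IH; have [->|w0] := eqVneq w [::].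
  by rewrite /pos_incr /=; case: ifP.
rewrite is_ascent_seq_rcons // pos_incr_rcons => /andP[aw ble] avwb.
have pw : pos_incr w by apply: IH => //; apply: avoids_all_subseq avwb; apply: subseq_rcons.
rewrite pw /=; case: posnP => //= b0; apply/allP => c cw; rewrite leqNgt.
apply/negP => bc; suff : ~~ avoids_all T (rcons w b) by rewrite avwb.
have [bw|bw] := boolP (b \in w).
  apply: (repeatT (b := b) (c := c)); first by rewrite b0.
  rewrite -[[:: 0; b; c; b]]/(rcons [:: 0; b; c] b) subseq_rcons_rcons eqxx.
  apply: subseq_zero_cons => //; first by rewrite !inE; lia.
  have bc' : b != c by lia.
  case/orP: (subseq_pair bc' bw cw) => // sub.
  by have := pairwise_filter_subseq2 pw sub; lia.
have w1 : 1 \in w.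
  by apply: ascent_seq_mem1 => //; have := ascent_seq_le_asc aw cw; lia.
have b1 : b != 1 by apply: contraNneq bw => ->.
apply: (skipT (b := b) (c := c)); first by lia.
rewrite -[[:: 0; 1; 0; c; b]]/(rcons [:: 0; 1; 0; c] b) subseq_rcons_rcons eqxx.
exact: pos_incr_skipped bc.
Qed.

End PosIncr.

Section Gt1Strict.
Variable T : seq (seq nat).
Hypothesis avoidT : forall w, gt1_strict w -> avoids_all T w.
Hypothesis repeatT : forall w b, 1 < b -> subseq [:: 0; 1; b; b] w ->
  ~~ avoids_all T w.
Hypothesis skip0T : forall w b c, 1 < b < c -> subseq [:: 0; 1; 0; c; b] w ->
  ~~ avoids_all T w.
Hypothesis skip1T : forall w b c, 2 < b < c -> subseq [:: 0; 1; 2; 1; c; b] w ->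
  ~~ avoids_all T w.

(** Suppose [b > 1] is appended and some earlier letter is at least [b]. If [b] occurred before, its
    first occurrence already needed an ascent, which gives [0 1 b b]. Otherwise a larger [c] skipped
    [b], which gives [0 1 0 c b] or [0 1 2 1 c b]; in the latter case [b > 2] since 2 has
    occurred. *)
Lemma avoids_gt1_strict w : is_ascent_seq w -> avoids_all T w = gt1_strict w.
Proof.
move=> aw; apply/idP/idP; last exact: avoidT.
elim/last_ind: w aw => // w b IH; have [->|w0] := eqVneq w [::].
  by rewrite /gt1_strict /=; case: ifP.
rewrite is_ascent_seq_rcons // gt1_strict_rcons => /andP[aw ble] avwb.
have pw : gt1_strict w by apply: IH => //; apply: avoids_all_subseq avwb; apply: subseq_rcons.
rewrite pw /=; case: leqP => //= b1; apply/allP => c cw; rewrite ltnNge.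
apply/negP => bc; suff : ~~ avoids_all T (rcons w b) by rewrite avwb.
have [bw|bw] := boolP (b \in w).
  apply: (repeatT (b := b)) => //.
  rewrite -[[:: 0; 1; b; b]]/(rcons [:: 0; 1; b] b) subseq_rcons_rcons eqxx.
  have [p [r [wE bp]]] := first_occurrence bw.
  rewrite wE; apply: (@cat_subseq _ [:: 0; 1] [:: b]); last by rewrite sub1seq mem_head.
  move: aw; rewrite wE -cat_rcons => /is_ascent_seq_cat.
  have [->|p0] := eqVneq p [::]; first by rewrite is_ascent_seq1; lia.
  rewrite is_ascent_seq_rcons // => /andP[ap bpe]; apply: subseq_01 => //.
  by apply: ascent_seq_mem1 => //; lia.
have {}bc : b < c by rewrite ltn_neqAle bc andbT; apply: contraNneq bw => ->.
case/orP: (gt1_strict_skipped aw pw cw bw bc) => sub.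
  apply: (skip0T (b := b) (c := c)); first by rewrite b1.
  by rewrite -[[:: 0; 1; 0; c; b]]/(rcons [:: 0; 1; 0; c] b) subseq_rcons_rcons eqxx.
have b2 : b != 2 by apply: contraNneq bw => ->; rewrite (mem_subseq sub) // !inE.
apply: (skip1T (b := b) (c := c)); first by lia.
by rewrite -[[:: 0; 1; 2; 1; c; b]]/(rcons [:: 0; 1; 2; 1; c] b) subseq_rcons_rcons eqxx.
Qed.

End Gt1Strict.

Lemma not_avoids_pair (u v : seq nat) w : ~~ avoids_all [:: u; v] w =
  contains w u || contains w v.
Proof. by rewrite avoids_pair negb_and !negbK. Qed.

Lemma pos_incr_no_descent w t b c : pos_incr w -> 0 < b < c -> subseq [:: c; b] t ->
  ~~ subseq t w.
Proof.
move=> pw bc cbt; apply/negP => /(subseq_trans cbt) /(pairwise_filter_subseq2 pw).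
by lia.
Qed.

Lemma gt1_strict_no_weak_descent t w b c : gt1_strict w -> 1 < b <= c -> subseq [:: c; b] t ->
  ~~ subseq t w.
Proof.
move=> pw bc cbt; apply/negP => /(subseq_trans cbt) /(pairwise_filter_subseq2 pw).
by lia.
Qed.

Lemma avoids_0021_0121 w : is_ascent_seq w ->
  avoids_all [:: [:: 0; 0; 2; 1]; [:: 0; 1; 2; 1]] w = pos_incr w.
Proof.
apply: avoids_pos_incr => {}w.
- move=> pw; rewrite avoids_pair; apply/andP; split; apply/negP.
    case/contains_0021P => a [b [c [abc]]]; apply/negP.
    by apply: (pos_incr_no_descent pw (b := b) (c := c)); [lia | apply: (suffix_subseq [:: a; a])].
  case/contains_0121P => a [b [c [abc]]]; apply/negP.
  by apply: (pos_incr_no_descent pw (b := b) (c := c)); [lia | apply: (suffix_subseq [:: a; b])].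
- move=> b c bc sub; rewrite not_avoids_pair; apply/orP; right.
  by apply/contains_0121P; exists 0, b, c.
- move=> b c bc sub; rewrite not_avoids_pair; apply/orP; left.
  apply/contains_0021P; exists 0, b, c; split; first lia.
  by apply: subseq_trans sub; rewrite /= !eqxx.
Qed.

Lemma avoids_0121_0132 w : is_ascent_seq w ->
  avoids_all [:: [:: 0; 1; 2; 1]; [:: 0; 1; 3; 2]] w = pos_incr w.
Proof.
apply: avoids_pos_incr => {}w.
- move=> pw; rewrite avoids_pair; apply/andP; split; apply/negP.
    case/contains_0121P => a [b [c [abc]]]; apply/negP.
    by apply: (pos_incr_no_descent pw (b := b) (c := c)); [lia | apply: (suffix_subseq [:: a; b])].
  case/contains_0132P => a [b [c [d [abcd]]]]; apply/negP.
  by apply: (pos_incr_no_descent pw (b := c) (c := d)); [lia | apply: (suffix_subseq [:: a; b])].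
- move=> b c bc sub; rewrite not_avoids_pair; apply/orP; left.
  by apply/contains_0121P; exists 0, b, c.
- move=> b c bc sub; rewrite not_avoids_pair; apply/orP; right.
  apply/contains_0132P; exists 0, 1, b, c; split; first lia.
  apply: subseq_trans sub; apply: (@cat_subseq _ [:: 0; 1] [:: c; b] [:: 0; 1; 0]) => //.
Qed.

Lemma avoids_0121_1032 w : is_ascent_seq w ->
  avoids_all [:: [:: 0; 1; 2; 1]; [:: 1; 0; 3; 2]] w = pos_incr w.
Proof.
apply: avoids_pos_incr => {}w.
- move=> pw; rewrite avoids_pair; apply/andP; split; apply/negP.
    case/contains_0121P => a [b [c [abc]]]; apply/negP.
    by apply: (pos_incr_no_descent pw (b := b) (c := c)); [lia | apply: (suffix_subseq [:: a; b])].
  case/contains_1032P => a [b [c [d [abcd]]]]; apply/negP.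
  by apply: (pos_incr_no_descent pw (b := c) (c := d)); [lia | apply: (suffix_subseq [:: b; a])].
- move=> b c bc sub; rewrite not_avoids_pair; apply/orP; left.
  by apply/contains_0121P; exists 0, b, c.
- move=> b c bc sub; rewrite not_avoids_pair; apply/orP; right.
  apply/contains_1032P; exists 0, 1, b, c; split; first lia.
  by apply: subseq_trans sub; apply: (suffix_subseq [:: 0]).
Qed.

Lemma avoids_0122_0132 w : is_ascent_seq w ->
  avoids_all [:: [:: 0; 1; 2; 2]; [:: 0; 1; 3; 2]] w = gt1_strict w.
Proof.
apply: avoids_gt1_strict => {}w.
- move=> pw; rewrite avoids_pair; apply/andP; split; apply/negP.
    case/contains_0122P => a [b [c [abc]]]; apply/negP.
    by apply: (gt1_strict_no_weak_descent pw (b := c) (c := c)); [lia | apply: (suffix_subseq [:: a; b])].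
  case/contains_0132P => a [b [c [d [abcd]]]]; apply/negP.
  by apply: (gt1_strict_no_weak_descent pw (b := c) (c := d)); [lia | apply: (suffix_subseq [:: a; b])].
- move=> b b1 sub; rewrite not_avoids_pair; apply/orP; left.
  by apply/contains_0122P; exists 0, 1, b.
- move=> b c bc sub; rewrite not_avoids_pair; apply/orP; right.
  apply/contains_0132P; exists 0, 1, b, c; split; first lia.
  apply: subseq_trans sub; apply: (@cat_subseq _ [:: 0; 1] [:: c; b] [:: 0; 1; 0]) => //.
- move=> b c bc sub; rewrite not_avoids_pair; apply/orP; right.
  apply/contains_0132P; exists 0, 1, b, c; split; first lia.
  apply: subseq_trans sub; apply: (@cat_subseq _ [:: 0; 1] [:: c; b] [:: 0; 1; 2; 1]) => //.
Qed.

Lemma avoids_0122_1032 w : is_ascent_seq w ->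
  avoids_all [:: [:: 0; 1; 2; 2]; [:: 1; 0; 3; 2]] w = gt1_strict w.
Proof.
apply: avoids_gt1_strict => {}w.
- move=> pw; rewrite avoids_pair; apply/andP; split; apply/negP.
    case/contains_0122P => a [b [c [abc]]]; apply/negP.
    by apply: (gt1_strict_no_weak_descent pw (b := c) (c := c)); [lia | apply: (suffix_subseq [:: a; b])].
  case/contains_1032P => a [b [c [d [abcd]]]]; apply/negP.
  by apply: (gt1_strict_no_weak_descent pw (b := c) (c := d)); [lia | apply: (suffix_subseq [:: b; a])].
- move=> b b1 sub; rewrite not_avoids_pair; apply/orP; left.
  by apply/contains_0122P; exists 0, 1, b.
- move=> b c bc sub; rewrite not_avoids_pair; apply/orP; right.
  apply/contains_1032P; exists 0, 1, b, c; split; first lia.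
  by apply: subseq_trans sub; apply: (suffix_subseq [:: 0]).
- move=> b c bc sub; rewrite not_avoids_pair; apply/orP; right.
  apply/contains_1032P; exists 1, 2, b, c; split; first lia.
  by apply: subseq_trans sub; apply: (suffix_subseq [:: 0; 1]).
Qed.

(* The maximum, except that an all-zero sequence has [top] equal to [1]. *)
Definition top (w : seq nat) := foldl maxn 1 w.

Lemma top_rcons w x : top (rcons w x) = maxn (top w) x.
Proof. exact: foldl_rcons. Qed.

Lemma all_leq_top w x : 0 < x -> all (fun y => y <= x) w = (top w <= x).
Proof.
move=> x0; elim/last_ind: w => [|w y IH]; first by rewrite /top /= x0.
by rewrite all_rcons IH top_rcons geq_max andbC.
Qed.

Lemma all_ltn_top w x : 1 < x -> all (fun y => y < x) w = (top w < x).
Proof. by case: x => // x x1; rewrite ltnS -all_leq_top. Qed.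

Lemma top_le_asc w : is_ascent_seq w -> top w <= maxn 1 (asc w).
Proof.
move=> aw; rewrite -all_leq_top; last by lia.
by apply/allP => y /(ascent_seq_le_asc aw); lia.
Qed.

Lemma pos_incr_top w : pos_incr w -> 0 < last 0 w -> top w = last 0 w.
Proof.
case/lastP: w => // w x; rewrite pos_incr_rcons last_rcons top_rcons.
case/andP=> _ /orP[/eqP -> //|+ x0]; rewrite all_leq_top //; lia.
Qed.

(* [(up, i, a)] is the node [U i] or [D i] of a sequence with [a] ascents. *)
Definition nar_label : eqType := (bool * nat * nat)%type.

(** In both classes the index is chosen so that [i + 1] of the allowed letters create an ascent.
    After a last letter 0 there is one more of them, namely [top w] in the first class and 1 in the
    second, whence the correction by [last 0 w == 0]. *)
Definition nar_label_of (w : seq nat) : nar_label :=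
  (0 < last 0 w, asc w + (last 0 w == 0) - top w, asc w).

(** The order is that of the allowed letters, increasing, so that labels of children can be compared
    as lists; a larger letter leaves a smaller index. *)
Definition nar_children (l : nar_label) : seq nar_label :=
  let: (up, i, a) := l in
  (if up then [:: (false, i.+1, a); (true, i, a)] else [:: (false, i, a)]) ++
  [seq (true, i - e, a.+1) | e <- iota 0 i.+1].

Lemma nar_label_of_rcons w x : w != [::] -> let a := asc w + (last 0 w < x) in
  nar_label_of (rcons w x) = (0 < x, a + (x == 0) - maxn (top w) x, a).
Proof. by move=> w0; rewrite /nar_label_of last_rcons asc_rcons // top_rcons. Qed.

Lemma top_gt0 w : 0 < top w.
Proof. by elim/last_ind: w => // w x; rewrite top_rcons; lia. Qed.

Lemma last_le_top w : last 0 w <= top w.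
Proof. by case/lastP: w => // w x; rewrite last_rcons top_rcons; lia. Qed.

(** * Allowed letters and labels of the children in the two Narayana classes *)

Definition pos_incr_allowed w := 0 :: iota (top w) ((asc w).+2 - top w).

Lemma pos_incr_allowedE w x : w != [::] -> is_ascent_seq w && pos_incr w ->
  (x \in pos_incr_allowed w) = is_ascent_seq (rcons w x) && pos_incr (rcons w x).
Proof.
move=> w0 /andP[aw pw]; rewrite is_ascent_seq_rcons // aw pos_incr_rcons pw /=.
have := top_le_asc aw; rewrite inE mem_iota.
by case: posnP => [->//|x0]; rewrite all_leq_top //; lia.
Qed.

Lemma pos_incr_allowed_uniq w : uniq (pos_incr_allowed w).
Proof.
by rewrite /= iota_uniq mem_iota; have := top_gt0 w; lia.
Qed.

Lemma iota_map_add m n : iota m n = [seq m + e | e <- iota 0 n].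
Proof. by rewrite -{1}[m]addn0 iotaDl. Qed.

Lemma pos_incr_labels w : w != [::] -> is_ascent_seq w && pos_incr w ->
  map nar_label_of (append_children pos_incr_allowed w) = nar_children (nar_label_of w).
Proof.
move=> w0 /andP[aw pw]; have tw := top_le_asc aw; have ptw := pos_incr_top pw.
have lw := last_le_asc aw; have lt := last_le_top w; have t0 := top_gt0 w.
rewrite /append_children /pos_incr_allowed -map_comp /nar_children {2}/nar_label_of.
rewrite map_cons [comp _ _ _]nar_label_of_rcons // ltn0 maxn0 !addn0.
case: (posnP (last 0 w)) => l0.
  rewrite addn1 cat1s; congr (_ :: _).
  rewrite (iota_map_add (top w)) -map_comp.
  have -> : (asc w).+2 - top w = ((asc w).+1 - top w).+1 by lia.
  apply/eq_in_map => e; rewrite mem_iota => eb /=.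
  by rewrite nar_label_of_rcons //; congr (_, _, _); lia.
rewrite cat_cons addn1 addn0; congr (_ :: _); first by congr (_, _, _); lia.
have -> : iota (top w) ((asc w).+2 - top w) =
  top w :: iota (top w).+1 (asc w - top w).+1.
  by have -> : (asc w).+2 - top w = (asc w - top w).+2 by lia.
rewrite map_cons [comp _ _ _]nar_label_of_rcons // cat1s.
congr (_ :: _); first by congr (_, _, _); lia.
rewrite (iota_map_add (top w).+1) -map_comp.
apply/eq_in_map => e; rewrite mem_iota => eb /=.
by rewrite nar_label_of_rcons //; congr (_, _, _); lia.
Qed.

Definition gt1_strict_allowed w := [:: 0, 1 & iota (top w).+1 ((asc w).+1 - top w)].

Lemma gt1_strict_allowedE w x : w != [::] -> is_ascent_seq w && gt1_strict w ->
  (x \in gt1_strict_allowed w) = is_ascent_seq (rcons w x) && gt1_strict (rcons w x).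
Proof.
move=> w0 /andP[aw pw]; rewrite is_ascent_seq_rcons // aw gt1_strict_rcons pw /=.
have := top_le_asc aw; rewrite !inE mem_iota; have := top_gt0 w.
by case: (leqP x 1) => x1 /=; [|rewrite all_ltn_top //]; lia.
Qed.

Lemma gt1_strict_allowed_uniq w : uniq (gt1_strict_allowed w).
Proof.
by rewrite /= iota_uniq inE !mem_iota; have := top_gt0 w; lia.
Qed.

Lemma gt1_strict_labels w : w != [::] -> is_ascent_seq w && gt1_strict w ->
  map nar_label_of (append_children gt1_strict_allowed w) = nar_children (nar_label_of w).
Proof.
move=> w0 /andP[aw pw]; have tw := top_le_asc aw.
have lw := last_le_asc aw; have lt := last_le_top w; have t0 := top_gt0 w.
rewrite /append_children /gt1_strict_allowed -map_comp /nar_children {2}/nar_label_of.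
rewrite 2!map_cons ![comp _ _ _]nar_label_of_rcons // ltn0 maxn0 !addn0.
case: (posnP (last 0 w)) => l0.
  rewrite addn1 cat1s -[iota 0 _.+1]/(0 :: iota 1 _) map_cons.
  congr [:: _, _ & _].
    by congr (_, _, _); lia.
  rewrite (iota_map_add (top w).+1) (iota_map_add 1) -!map_comp.
  apply/eq_in_map => e; rewrite mem_iota => eb /=.
  by rewrite nar_label_of_rcons //; congr (_, _, _); lia.
rewrite 2!cat_cons addn1 addn0; congr [:: _, _ & _]; try by congr (_, _, _); lia.
have -> : (asc w).+1 - top w = (asc w - top w).+1 by lia.
rewrite (iota_map_add (top w).+1) -map_comp.
apply/eq_in_map => e; rewrite mem_iota => eb /=.
by rewrite nar_label_of_rcons //; congr (_, _, _); lia.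
Qed.

(** * Narayana polynomials *)

Section NarayanaPoly.
Import GRing.Theory.
Local Open Scope ring_scope.

(* Motzkin paths of length [l] from height [i] to height [0]. *)
Fixpoint motzkin_poly (l i : nat) : {poly int} :=
  if l is l'.+1 then
    (1 + 'X) * motzkin_poly l' i + 'X * motzkin_poly l' i.+1 +
    (if i is i'.+1 then motzkin_poly l' i' else 0)
  else (i == 0)%:R.

Lemma motzkin_polySS l i : motzkin_poly l.+1 i.+1 =
  (1 + 'X) * motzkin_poly l i.+1 + 'X * motzkin_poly l i.+2 + motzkin_poly l i.
Proof. by []. Qed.

Lemma motzkin_poly_gt l i : (l < i)%N -> motzkin_poly l i = 0.
Proof.
by elim: l i => [|l IH] [|i] //= li; rewrite !IH ?mulr0 ?addr0 //; lia.
Qed.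

Lemma motzkin_poly_diag i : motzkin_poly i i = 1.
Proof.
elim: i => //= i ->; rewrite !motzkin_poly_gt //.
by rewrite !mulr0 !add0r.
Qed.

(** Multiplication by the length variable [t], on coefficient sequences. *)
Definition delay (f : nat -> {poly int}) k := if k is k'.+1 then f k' else 0.

(* The coefficient of [t ^ k] in [(1 - t)^j H^(i+1)]: a path from height [i] to [0]
   is a product of [i + 1] paths from [0] to [0] and [i] down steps. *)
Fixpoint diff_poly (i j k : nat) : {poly int} :=
  if j is j'.+1 then diff_poly i j' k - delay (diff_poly i j') k
  else motzkin_poly (k + i) i.

(** The functional equation [(1 - t) H = 1 + z t H + z t^2 H^2] multiplied by [(1 - t)^j H^(i+1)].
    For [j = 0] it is the decomposition by the first step; the other cases follow by linearity. *)
Lemma diff_polyS i j k : diff_poly i.+1 j.+1 k =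
  diff_poly i j k + 'X * delay (diff_poly i.+1 j) k +
  'X * delay (delay (diff_poly i.+2 j)) k.
Proof.
elim: j k => [|j IH] k.
  case: k => [|k].
    change (motzkin_poly (0 + i.+1) i.+1 - 0 =
      motzkin_poly (0 + i) i + 'X * 0 + 'X * 0 :> {poly int}).
    by rewrite !add0n !motzkin_poly_diag; ring.
  change (motzkin_poly (k + i.+1).+1 i.+1 - motzkin_poly (k + i.+1) i.+1 =
    motzkin_poly (k.+1 + i) i + 'X * motzkin_poly (k + i.+1) i.+1 +
    'X * delay (diff_poly i.+2 0) k).
  have -> : delay (diff_poly i.+2 0) k = motzkin_poly (k + i.+1) i.+2.
    by case: k => [|k]; [rewrite motzkin_poly_gt | rewrite addSnnS].
  by rewrite motzkin_polySS addSnnS; ring.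
have delayS i' k' : delay (diff_poly i' j.+1) k' =
    delay (diff_poly i' j) k' - delay (delay (diff_poly i' j)) k'.
  by case: k' => //=; rewrite subr0.
have delay2S i' k' : delay (delay (diff_poly i' j.+1)) k' =
    delay (delay (diff_poly i' j)) k' - delay (delay (delay (diff_poly i' j))) k'.
  by case: k' => [|k'] /=; rewrite ?subr0 ?delayS.
have delayIH : delay (diff_poly i.+1 j.+1) k = delay (diff_poly i j) k +
    'X * delay (delay (diff_poly i.+1 j)) k +
    'X * delay (delay (delay (diff_poly i.+2 j))) k.
  by case: k => [|k]; [rewrite /= mulr0 !addr0 | exact: IH].
change (diff_poly i.+1 j.+1 k - delay (diff_poly i.+1 j.+1) k =
  diff_poly i j k - delay (diff_poly i j) k + 'X * delay (diff_poly i.+1 j.+1) k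
  + 'X * delay (delay (diff_poly i.+2 j.+1)) k).
rewrite {1}delayIH IH delayS delay2S; ring.
Qed.

Lemma diff_poly01 k : diff_poly 0 1 k.+1 =
  'X * (diff_poly 0 0 k + delay (diff_poly 1 0) k).
Proof.
rewrite /= !addn0; have -> : motzkin_poly k 1 = delay (diff_poly 1 0) k.
  by case: k => // k; rewrite /= addn1.
by rewrite /=; ring.
Qed.

(* The generating function below [U i] is [D i + t / (1 - t) * D (i+1)], and the factor
   [1 - t] cancels because [D (i+1)] is divisible by it. *)
Definition nar_poly (up : bool) i k : {poly int} :=
  diff_poly i i k + (if up then delay (diff_poly i.+1 i) k else 0).

Lemma nar_poly0 up i : nar_poly up i 0 = 1.
Proof.
rewrite /nar_poly /= if_same addr0.
suff H j : diff_poly i j 0 = 1 by [].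
by elim: j => [|j IH] /=; rewrite ?motzkin_poly_diag // IH subr0.
Qed.

(** The difference of two consecutive coefficients of [D i] is a coefficient of
    [(1 - t)^(i+1) H^(i+1)]. By [diff_polyS], passing from [i] to [i + 1] there adds exactly
    ['X * nar_poly true i.+1 k], so the sum telescopes. *)
Lemma nar_poly_down i k : nar_poly false i k.+1 =
  nar_poly false i k + 'X * \sum_(j < i.+1) nar_poly true j k.
Proof.
suff H : diff_poly i i.+1 k.+1 = 'X * \sum_(j < i.+1) nar_poly true j k.
  by rewrite -H /nar_poly /=; ring.
elim: i => [|i IH]; first by rewrite diff_poly01 big_ord1.
rewrite big_ord_recr mulrDr -IH diff_polyS /nar_poly /delay.
by rewrite [nat_of_ord _]/=; ring.
Qed.

Lemma nar_poly_up i k : nar_poly true i k.+1 =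
  nar_poly false i.+1 k + nar_poly true i k + 'X * \sum_(j < i.+1) nar_poly true j k.
Proof.
have -> : nar_poly true i k.+1 = nar_poly false i k.+1 + diff_poly i.+1 i k.
  by rewrite /nar_poly /delay addr0.
have -> : nar_poly false i.+1 k = diff_poly i.+1 i k - delay (diff_poly i.+1 i) k.
  by rewrite /nar_poly addr0.
have -> : nar_poly true i k = nar_poly false i k + delay (diff_poly i.+1 i) k.
  by rewrite /nar_poly addr0.
by rewrite nar_poly_down; ring.
Qed.

Lemma sum_level (X : eqType) (ch : X -> seq X) (h : X -> {poly int}) k s :
  \sum_(z <- level ch k s) h z = \sum_(x <- s) \sum_(z <- level ch k [:: x]) h z.
Proof. by rewrite level_flatten big_flatten big_map. Qed.

Lemma sum_nar_level k up i a :
  \sum_(l <- level nar_children k [:: (up, i, a)]) 'X^(l.2) = 'X^a * nar_poly up i k.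
Proof.
elim: k up i a => [|k IH] up i a; first by rewrite /= big_seq1 nar_poly0 mulr1.
rewrite levelSr sum_level; set l := (up, i, a).
have -> : flatten [seq nar_children x | x <- [:: l]] = nar_children l by rewrite /= cats0.
rewrite /nar_children /l {l} big_cat big_map.
have -> : \sum_(e <- iota 0 i.+1)
    \sum_(z <- level nar_children k [:: (true, (i - e)%N, a.+1)]) 'X^(z.2) =
  'X^a * ('X * \sum_(j < i.+1) nar_poly true j k).
  rewrite -[in iota _ _](subn0 i.+1) -/(index_iota _ _) big_mkord.
  rewrite (reindex_inj rev_ord_inj) mulrA -exprSr mulr_sumr.
  by apply: eq_bigr => j _; rewrite IH /= subSS subKn // -ltnS.
case: up; rewrite !big_cons big_nil !IH ?nar_poly_up ?nar_poly_down /=; ring.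
Qed.

(** The binomial with lower index [m - 1], equal to 0 at [m = 0], where ['C(l, m.-1)] would be 1. *)
Definition bin_pred l m := if m is m'.+1 then 'C(l, m') else 0%N.

(* Reflection principle: the coefficients count pairs of lattice paths. *)
Lemma coef_motzkin_poly l i m : (motzkin_poly l i)`_m =
  ('C(l, m) * 'C(l, m + i))%:R - (bin_pred l m * 'C(l, (m + i).+1))%:R.
Proof.
elim: l i m => [|l IH] i m.
  rewrite /= -polyC_natr coefC; case: m => [|m] /=; rewrite !bin0n ?muln0 ?subr0 //.
  by case: i.
rewrite [motzkin_poly _ _]/= mulrDl mul1r !coefD !coefXM.
case: m => [|m] /=.
  rewrite mul0n subr0 !addr0 IH /= mul0n subr0 !bin0 !mul1n !add0n.
  case: i => [|i]; first by rewrite coef0 addr0 !bin0.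
  by rewrite IH binS /= bin0 mul1n mul0n subr0 add0n natrD.
have predS : 'C(l.+1, m) = ('C(l, m) + bin_pred l m)%N.
  by case: m => [|m]; rewrite ?bin0 // binS.
rewrite predS; case: i => [|i]; rewrite ?coef0 !IH /= !addSn !addnS ?addn0 !binS !natrM !natrD;
  ring.
Qed.

End NarayanaPoly.

(** * Narayana numbers as determinants, and their sum *)

Lemma bin_pred_left l m : m <= l -> (l - m).+1 * bin_pred l m = m * 'C(l, m).
Proof.
case: m => [|m] ml; first by rewrite muln0.
by rewrite mul_bin_left -subSn //= subSS.
Qed.

(** The shape in which the reflection principle delivers Narayana numbers, namely
    [coef_motzkin_poly] at height 0. *)
Lemma narayanaE k m : m <= k ->
  bin_pred k m * 'C(k, m.+1) + narayana k.+1 m.+1 = 'C(k, m) * 'C(k, m).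
Proof.
move=> mk; have bl := bin_pred_left mk; have dl := mul_bin_left k m.
have binS' : 'C(k.+1, m) = 'C(k, m) + bin_pred k m by case: (m) => [|i]; rewrite ?bin0 ?binS.
rewrite /narayana /= binS binS'.
move: ('C(k, m)) ('C(k, m.+1)) (bin_pred k m) bl dl => c d b bl dl.
(* The equality makes the division by [k.+1] exact; the inequality keeps the subtraction from being
   truncated. *)
suff E : (d + c) * (c + b) = (c * c - b * d) * k.+1 /\ b * d <= c * c.
  by case: E => -> le; rewrite mulnK // subnKC.
have E : k.+1 * (b * d) + (d + c) * (c + b) = k.+1 * (c * c).
  (* After multiplication by [m + 1] and [k - m + 1], both neighbouring binomials become multiples
     of ['C(k, m)]. *)
  apply/eqP; rewrite -(eqn_pmul2l (_ : 0 < m.+1 * (k - m).+1)) //; apply/eqP.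
  have [j kE] : exists j, k = m + j by exists (k - m); lia.
  move: bl dl; rewrite kE addKn => bl dl.
  transitivity ((m + j).+1 * ((j.+1 * b) * (m.+1 * d)) +
    (m.+1 * d + m.+1 * c) * (j.+1 * c + j.+1 * b)); first by ring.
  by rewrite bl dl; ring.
by split; [rewrite mulnBl; lia | nia].
Qed.

(** Vandermonde's identity sums the two products of the determinant form to ['C(k + k, k)] and
    ['C(k + k, k.+2)], whose difference is the Catalan number. *)
Lemma sum_narayana k : \sum_(m < k.+1) narayana k.+1 m.+1 = catalan k.+1.
Proof.
have E1 : \sum_(m < k.+1) 'C(k, m) * 'C(k, m) = 'C(k + k, k).
  rewrite -binomial.Vandermonde; apply: eq_bigr => m _.
  by rewrite bin_sub // -ltnS.
have E2 : \sum_(m < k.+1) bin_pred k m * 'C(k, m.+1) = 'C(k + k, k.+2).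
  rewrite -binomial.Vandermonde [RHS]big_ord_recl [X in _ = _ + X]big_ord_recr /=.
  rewrite bin0 mul1n subn0 ['C(k, k.+2)]bin_small // add0n.
  rewrite mul0n addn0.
  apply: eq_bigr => -[m mk] _ /=; rewrite /bump /= add1n mulnC; congr (_ * _).
  case: m mk => [|m] mk /=; first by rewrite bin_small.
  by rewrite !subSS bin_sub //; lia.
have E3 : 'C(k + k, k.+2) + \sum_(m < k.+1) narayana k.+1 m.+1 = 'C(k + k, k).
  rewrite -E1 -E2 -big_split /=; apply: eq_bigr => m _.
  by rewrite narayanaE // -ltnS.
have b1 := mul_bin_left (k + k) k; have b2 := mul_bin_left (k + k) k.+1.
rewrite /catalan; have -> : 'C(k.+1.*2, k.+1) = (\sum_(m < k.+1) narayana k.+1 m.+1) * k.+2.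
  have -> : k.+1.*2 = (k + k).+2 by lia.
  have b0 : 'C((k + k).+1, k) = 'C((k + k).+1, k.+1).
    by rewrite -[RHS]bin_sub ?ltnS ?leq_addl // subSS addnK.
  rewrite binS b0 binS; move: E3 b1 b2.
  have -> : k + k - k = k by lia.
  have -> : k + k - k.+1 = k.-1 by lia.
  move: ('C(k + k, k)) ('C(k + k, k.+1)) ('C(k + k, k.+2)) (\sum_(m < _) _) => c b d s.
  by case: (k) => [|j] /=; nia.
by rewrite mulnK.
Qed.

(** * The pairs (0010,0021) and (0011,0021) *)

(* [true] stands for the pair (0010,0021), [false] for (0011,0021); [in_gap b a c z]
   says that [a a c z] is an occurrence of one of the two patterns. *)
Definition in_gap (b : bool) x y z := if b then x <= z < y else x < z <= y.

Definition forbidden b (w : seq nat) z :=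
  has (fun a => has (fun c => in_gap b a c z && subseq [:: a; a; c] w) w) w.

Lemma forbiddenP b w z :
  reflect (exists a c, in_gap b a c z /\ subseq [:: a; a; c] w) (forbidden b w z).
Proof.
apply: (iffP hasP) => [[a aw /hasP[c cw /andP[g sub]]]|[a [c [g sub]]]].
  by exists a, c.
exists a; first by rewrite (mem_subseq sub) ?mem_head.
by apply/hasP; exists c; rewrite ?g // (mem_subseq sub) ?inE ?eqxx ?orbT.
Qed.

Definition gap_pair (b : bool) : seq (seq nat) :=
  [:: if b then [:: 0; 0; 1; 0] else [:: 0; 0; 1; 1]; [:: 0; 0; 2; 1]].

(** The closed end of the gap yields the first pattern of the pair and its interior yields 0021;
    hence one predicate serves both pairs. *)
Lemma gap_pairP b w :
  reflect (exists a c z, in_gap b a c z /\ subseq [:: a; a; c; z] w)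
          (~~ avoids_all (gap_pair b) w).
Proof.
rewrite avoids_pair negb_and !negbK /in_gap; case: b; apply: (iffP orP).
- case=> [/contains_0010P[a [c [ac sub]]]|/contains_0021P[a [z [c [azc sub]]]]].
    by exists a, c, a; rewrite leqnn.
  by exists a, c, z; split=> //; lia.
- case=> a [c [z [azc sub]]]; have [E|ne] := eqVneq z a.
    by left; apply/contains_0010P; exists a, c; split; [lia | rewrite -{3}E].
  by right; apply/contains_0021P; exists a, z, c; split=> //; lia.
- case=> [/contains_0011P[a [c [ac sub]]]|/contains_0021P[a [z [c [azc sub]]]]].
    by exists a, c, c; rewrite leqnn andbT.
  by exists a, c, z; split=> //; lia.
- case=> a [c [z [azc sub]]]; have [E|ne] := eqVneq z c.
    by left; apply/contains_0011P; exists a, c; split; [lia | rewrite -{2}E].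
  by right; apply/contains_0021P; exists a, z, c; split=> //; lia.
Qed.

Lemma gap_pair_rcons b w z : avoids_all (gap_pair b) (rcons w z) =
  avoids_all (gap_pair b) w && ~~ forbidden b w z.
Proof.
apply/idP/andP => [av|[av fb]].
  split; first exact: avoids_all_subseq (subseq_rcons _ _) av.
  apply: contraL av => /forbiddenP[a [c [g sub]]]; apply/gap_pairP; exists a, c, z.
  by split=> //; rewrite (subseq_rcons_rcons [:: a; a; c]) eqxx.
apply: contraNT fb => /gap_pairP[a [c [y [g]]]].
rewrite (subseq_rcons_rcons [:: a; a; c]); case: eqP => [<- sub|_ sub].
  by apply/forbiddenP; exists a, c.
by case/negP: (introT (gap_pairP b w) (ex_intro _ a (ex_intro _ c (ex_intro _ y (conj g sub))))).
Qed.

Definition gap_allowed b w := [seq z <- iota 0 (asc w).+2 | ~~ forbidden b w z].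

Lemma gap_allowedE b w z : w != [::] ->
  is_ascent_seq w && avoids_all (gap_pair b) w ->
  (z \in gap_allowed b w) =
  is_ascent_seq (rcons w z) && avoids_all (gap_pair b) (rcons w z).
Proof.
move=> w0 /andP[aw avw].
by rewrite mem_filter mem_iota is_ascent_seq_rcons // gap_pair_rcons aw avw andbC.
Qed.

Lemma subseq_repeat (w : seq nat) x : subseq [:: x; x] w = (1 < count_mem x w).
Proof.
elim: w => //= y w IH; rewrite [y == x]eq_sym; case: eqP => _ /=; last exact: IH.
by rewrite sub1seq -has_pred1 has_count.
Qed.

(** The state once some letter is repeated. Letters below [x] occur exactly once, so appending one
    of them makes it the new smallest repeated letter. The last two clauses make the last letter the
    far end of a gap opened by [x], unless it is [x] itself. *)
Definition min_repeat (w : seq nat) x :=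
  [/\ 1 < count_mem x w, forall a, a < x -> count_mem a w = 1,
      x <= last 0 w & last 0 w = x \/ subseq [:: x; x; last 0 w] w].

Definition first_repeat (w : seq nat) :=
  find (fun a => 1 < count_mem a w) (iota 0 (size w)).

Lemma find_iota (p : pred nat) n x : p x -> x < n -> (forall a, a < x -> ~~ p a) ->
  find p (iota 0 n) = x.
Proof.
move=> px xn Hx; rewrite -(subnKC (ltnW xn)) iotaD find_cat add0n.
rewrite (negbTE (_ : ~~ has p (iota 0 x))); last first.
  by apply/hasPn => a; rewrite mem_iota; apply: Hx.
by rewrite size_iota -(subnSK xn) /= px addn0.
Qed.

Lemma min_repeatE w x : is_ascent_seq w -> min_repeat w x -> first_repeat w = x.
Proof.
move=> aw [cx cl _ _]; have xw : x \in w by rewrite -has_pred1 has_count; lia.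
apply: find_iota => //; last by move=> a /cl ->.
apply: leq_ltn_trans (ascent_seq_le_asc aw xw) _.
by apply: asc_lt_size; case: (w) xw.
Qed.

Lemma iota_rcons m n : iota m n.+1 = rcons (iota m n) (m + n).
Proof. by rewrite -addn1 iotaD cats1. Qed.

Lemma last_iota n : last 0 (iota 0 n.+1) = n.
Proof. by rewrite iota_rcons last_rcons. Qed.

Lemma asc_iota n : asc (iota 0 n.+1) = n.
Proof. by elim: n => // n IH; rewrite iota_rcons asc_rcons // IH last_iota ltnSn addn1. Qed.

Lemma uniq_ascent_seq w : is_ascent_seq w -> uniq w -> w = iota 0 (size w).
Proof.
elim/last_ind: w => // w x IH; have [->|w0] := eqVneq w [::].
  by rewrite is_ascent_seq1 => /eqP ->.
rewrite is_ascent_seq_rcons // rcons_uniq size_rcons => /andP[aw xle] /andP[xw uw].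
have wE := IH aw uw; have sw : size w = (size w).-1.+1 by case: (w) w0.
move: xle xw; rewrite {1 2}wE {1}sw asc_iota -sw mem_iota => xle xw.
by rewrite iota_rcons -wE; congr rcons; lia.
Qed.

Lemma min_repeat_rcons w x z : min_repeat w x ->
  min_repeat (rcons w z) (minn x z).
Proof.
case=> cx cl xl lx; have [xz|zx] := leqP x z.
  split; rewrite ?last_rcons //; first by rewrite -cats1 count_cat; lia.
    move=> a ax; rewrite -cats1 count_cat cl //= gtn_eqF //; lia.
  have [->|zx] := eqVneq z x; first by left.
  by right; rewrite (subseq_rcons_rcons [:: x; x]) eqxx subseq_repeat.
split; rewrite ?last_rcons //; last by left.
  by rewrite -cats1 count_cat cl //= eqxx.
by move=> a az; rewrite -cats1 count_cat cl /= ?gtn_eqF //; lia.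
Qed.

Lemma min_repeat_iota n z : z <= n -> min_repeat (rcons (iota 0 n.+1) z) z.
Proof.
move=> zn; have count1 a : a <= n -> count_mem a (iota 0 n.+1) = 1.
  by move=> an; rewrite count_uniq_mem ?iota_uniq // mem_iota /= ltnS an.
split; rewrite ?last_rcons //; last by left.
  by rewrite -cats1 count_cat count1 //= eqxx.
by move=> a az; rewrite -cats1 count_cat count1 /= ?gtn_eqF //; lia.
Qed.

Lemma min_repeat_exists w : is_ascent_seq w -> ~~ uniq w -> exists x, min_repeat w x.
Proof.
elim/last_ind: w => // w z IH; have [->//|w0] := eqVneq w [::].
rewrite is_ascent_seq_rcons // rcons_uniq => /andP[aw zle].
have [uw|/(IH aw)[x mx] _] := boolP (uniq w); last first.
  by exists (minn x z); apply: min_repeat_rcons.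
rewrite andbT negbK => zw; exists z.
have wE := uniq_ascent_seq aw uw; have sw : size w = (size w).-1.+1 by case: (w) w0.
by move: zw; rewrite wE sw mem_iota => zw; apply: min_repeat_iota.
Qed.

(* [(M, None)] is the sequence [0 1 .. M]. *)
Definition gap_label : eqType := (nat * option nat)%type.

Definition gap_label_of b w : gap_label :=
  if uniq w then (asc w, None) else (size (gap_allowed b w) - 2, Some (first_repeat w)).

(** For [Some x]: letters below [x] become the smallest repeated letter; the single allowed letter
    from [x] to the last letter changes nothing; the letter number [j] above the last one, counted
    from 0, costs [j] allowed letters. *)
Definition gap_children (l : gap_label) : seq gap_label :=
  match l with
  | (M, None) => rcons [seq (M, Some z) | z <- iota 0 M.+1] (M.+1, None)
  | (M, Some x) => [seq (M, Some z) | z <- iota 0 x] ++ (M, Some x) ::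
                   [seq (M - j, Some x) | j <- iota 0 (M.+1 - x)]
  end.

Lemma gap_label_of_repeat b w x : is_ascent_seq w -> min_repeat w x ->
  gap_label_of b w = (size (gap_allowed b w) - 2, Some x).
Proof.
move=> aw mx; rewrite /gap_label_of (min_repeatE aw mx); case: ifP => // uw.
by case: mx; rewrite count_uniq_mem // => + _ _ _; case: (_ \in _).
Qed.

Lemma forbidden_uniq b w z : uniq w -> forbidden b w z = false.
Proof.
move=> uw; apply/forbiddenP => -[a [c [_ sub]]].
have : subseq [:: a; a] w by apply: subseq_trans sub; rewrite /= !eqxx.
by move/subseq_uniq => /(_ uw); rewrite /= inE eqxx.
Qed.

Lemma forbidden_rcons_uniq b w z y : uniq w -> forbidden b (rcons w z) y = false.
Proof.
move=> uw; apply/forbiddenP => -[a [c [_]]].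
rewrite (subseq_rcons_rcons [:: a; a]); case: eqP => _ sub.
  by have := subseq_uniq sub uw; rewrite /= inE eqxx.
have : subseq [:: a; a] w by apply: subseq_trans sub; rewrite /= !eqxx.
by move/subseq_uniq => /(_ uw); rewrite /= inE eqxx.
Qed.

(** Among the gaps that the new letter [z] closes, the one opened by the smallest repeated letter
    [x] contains all the others. *)
Lemma forbidden_rcons b w x z y : min_repeat w x ->
  forbidden b (rcons w z) y = forbidden b w y || in_gap b x z y.
Proof.
case=> cx cl _ _; apply/forbiddenP/orP => [[a [c [g]]]|[/forbiddenP[a [c [g sub]]]|g]].
- rewrite (subseq_rcons_rcons [:: a; a]); case: eqP => [cz sub|_ sub].
    right; have xa : x <= a.
      by rewrite leqNgt; apply: contraL sub => /cl; rewrite subseq_repeat => ->.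
    by move: g; rewrite cz /in_gap; case: (b); lia.
  by left; apply/forbiddenP; exists a, c.
- by exists a, c; split=> //; apply: subseq_trans sub (subseq_rcons _ _).
- exists x, z; split=> //.
  by rewrite (subseq_rcons_rcons [:: x; x]) eqxx subseq_repeat.
Qed.

Lemma count_geq_nth (s : seq nat) j : sorted ltn s -> j < size s ->
  count (fun y => nth 0 s j <= y) s = size s - j /\
  count (fun y => nth 0 s j < y) s = size s - j.+1.
Proof.
elim: s j => //= h t IH j; rewrite path_sortedE; last exact: ltn_trans.
case/andP=> /allP ht st; case: j => [|j] jt /=.
  rewrite leqnn ltnn subn0 subSS subn0 add1n add0n; split; [congr _.+1|];
    by apply/eqP; rewrite -all_count; apply/allP => y /ht /=; lia.
have [-> ->] := IH j st jt; have := ht _ (mem_nth 0 jt).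
by move=> /= hn; rewrite !subSS; lia.
Qed.

(** * One step in the tree of the gap pairs, after the first repetition *)

Section GapStep.
Variables (b : bool) (w : seq nat) (x : nat).
Hypotheses (w0 : w != [::]) (aw : is_ascent_seq w) (avw : avoids_all (gap_pair b) w).
Hypothesis mx : min_repeat w x.

(** The pivot [g] is the only allowed letter from [x] up to the last letter: the gap from [x] to the
    last letter excludes all others. [F] collects the allowed letters above the last one. *)
Let g := if b then last 0 w else x.
Let F := [seq z <- iota (last 0 w).+1 ((asc w).+1 - last 0 w) | ~~ forbidden b w z].

Lemma forbidden_lt_repeat z : z < x -> ~~ forbidden b w z.
Proof.
move=> zx; apply/forbiddenP => -[a [c [ga sub]]].
have : subseq [:: a; a] w by apply: subseq_trans sub; rewrite /= !eqxx.
case: mx => _ cl _ _; rewrite subseq_repeat.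
by case: (ltnP a x) => [/cl ->//|xa]; move: ga; rewrite /in_gap; case: (b); lia.
Qed.

Lemma forbidden_lt_last z : in_gap b x (last 0 w) z -> forbidden b w z.
Proof.
move=> gz; apply/forbiddenP; exists x, (last 0 w); split=> //.
case: mx => _ _ _ [lx|//]; move: gz; rewrite lx /in_gap; case: (b); lia.
Qed.

(** For [true], the last letter was itself allowed when appended, and a gap that it closes does not
    contain it. For [false], a gap containing [x] would be opened by a repeated letter below [x]. *)
Lemma forbidden_pivot : ~~ forbidden b w g.
Proof.
rewrite /g; case: b avw => [avw'|_].
  case/lastP: w w0 avw' => // u l _; rewrite last_rcons gap_pair_rcons => /andP[_].
  apply: contra => /forbiddenP[a [c [ga]]]; rewrite (subseq_rcons_rcons [:: a; a]).
  case: eqP => [cl|_ sub]; first by move: ga; rewrite /in_gap cl; lia.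
  by apply/forbiddenP; exists a, c.
apply/forbiddenP => -[a [c [ga sub]]].
have : subseq [:: a; a] w by apply: subseq_trans sub; rewrite /= !eqxx.
case: mx => _ cl _ _; rewrite subseq_repeat.
by case: (ltnP a x) => [/cl ->//|xa]; move: ga; rewrite /in_gap; lia.
Qed.

Lemma gap_allowed_split : gap_allowed b w = iota 0 x ++ g :: F.
Proof.
have [_ _ xl _] := mx; have lA := last_le_asc aw.
rewrite /gap_allowed.
have -> : (asc w).+2 = x + ((last 0 w - x).+1 + ((asc w).+1 - last 0 w)) by lia.
rewrite !iotaD !filter_cat add0n addnS subnKC // -/F; congr (_ ++ _).
  by apply/all_filterP/allP => z; rewrite mem_iota; apply: forbidden_lt_repeat.
rewrite -cat1s; congr (_ ++ _); have := forbidden_pivot; rewrite /g.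
case: b forbidden_lt_last => fl.
  rewrite iota_rcons subnKC // filter_rcons => ->.
  rewrite (eq_in_filter (a2 := pred0)) ?filter_pred0 // => z.
  by rewrite mem_iota => zl; rewrite fl // /in_gap; lia.
rewrite /= => ->; congr (_ :: _).
rewrite (eq_in_filter (a2 := pred0)) ?filter_pred0 // => z.
by rewrite mem_iota => zl; rewrite fl // /in_gap; lia.
Qed.

Lemma size_gap_allowed : size (gap_allowed b w) = x + (size F).+1.
Proof. by rewrite gap_allowed_split size_cat size_iota. Qed.

Lemma gap_allowed_gt0 : 0 < size F.
Proof.
have lA := last_le_asc aw.
rewrite size_filter -has_count; apply/hasP; exists (asc w).+1.
  by rewrite mem_iota; lia.
apply/forbiddenP => -[a [c [ga sub]]].
have : c <= asc w.
  by apply: ascent_seq_le_asc => //; rewrite (mem_subseq sub) // !inE eqxx !orbT.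
by move: ga; rewrite /in_gap; case: (b); lia.
Qed.

(** There is no new ascent, and the gap from [x] to [z] lies inside the gap from [x] to the last
    letter, which is already forbidden. *)
Lemma gap_allowed_le z : z <= last 0 w -> ~~ forbidden b w z ->
  gap_allowed b (rcons w z) = gap_allowed b w.
Proof.
move=> zl fz; rewrite /gap_allowed asc_rcons // ltnNge zl addn0.
apply: eq_filter => y; rewrite (forbidden_rcons _ _ _ mx).
case: (boolP (in_gap b x z y)) => gy; last by rewrite orbF.
rewrite orbT; apply/esym/negbTE; rewrite negbK; apply: forbidden_lt_last.
by move: gy; rewrite /in_gap; case: (b); lia.
Qed.

(** The new ascent admits one more letter, and the new gap removes [j + 1]: for [true] the pivot and
    the [j] letters of [F] below [z], for [false] the [j + 1] letters of [F] up to [z]. *)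
Lemma size_gap_allowed_gt j : j < size F ->
  size (gap_allowed b (rcons w (nth 0 F j))) = size (gap_allowed b w) - j.
Proof.
move=> jF; set z := nth 0 F j; have lA := last_le_asc aw; have [_ _ xl _] := mx.
have /andP[lz zA] : last 0 w < z <= (asc w).+1.
  have : z \in F by apply: mem_nth.
  by rewrite mem_filter mem_iota; lia.
have sF : sorted ltn F by apply: sorted_filter; [exact: ltn_trans | exact: iota_ltn_sorted].
have [cge cgt] := count_geq_nth sF jF.
have -> : gap_allowed b (rcons w z) =
    rcons [seq y <- gap_allowed b w | ~~ in_gap b x z y] (asc w).+2.
  rewrite /gap_allowed asc_rcons // lz addn1 iota_rcons filter_rcons.
  rewrite (forbidden_rcons _ _ _ mx) negb_or.
  have -> : forbidden b w (asc w).+2 = false.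
    apply/forbiddenP => -[a [c [ga sub]]].
    have : c <= asc w.
      by apply: ascent_seq_le_asc => //; rewrite (mem_subseq sub) // !inE eqxx !orbT.
    by move: ga; rewrite /in_gap; case: (b); lia.
  have -> : in_gap b x z (0 + (asc w).+2) = false by rewrite /in_gap; case: (b); lia.
  rewrite -filter_predI [~~ false && _]/=; congr rcons; apply: eq_filter => y /=.
  by rewrite (forbidden_rcons _ _ _ mx) negb_or andbC.
rewrite size_rcons size_gap_allowed gap_allowed_split filter_cat size_cat /=.
have -> : [seq y <- iota 0 x | ~~ in_gap b x z y] = iota 0 x.
  apply/all_filterP/allP => y; rewrite mem_iota /in_gap; case: (b); lia.
rewrite size_iota; have F_lt y : y \in F -> last 0 w < y.
  by rewrite mem_filter mem_iota; lia.
move: cge cgt; rewrite -/z => cge cgt.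
rewrite /g; case: b F_lt => F_lt.
  have -> : in_gap true x z (last 0 w) by rewrite /in_gap; lia.
  rewrite size_filter (eq_in_count (a2 := fun y => z <= y)) ?cge; first lia.
  by move=> y /F_lt; rewrite /in_gap /=; lia.
have -> /= : in_gap false x z x = false by rewrite /in_gap ltnn.
rewrite size_filter (eq_in_count (a2 := fun y => z < y)) ?cgt; first lia.
by move=> y /F_lt; rewrite /in_gap /=; lia.
Qed.

Lemma gap_labels_repeat :
  map (gap_label_of b) (append_children (gap_allowed b) w) =
  gap_children (gap_label_of b w).
Proof.
have [_ _ xl _] := mx; have F0 := gap_allowed_gt0.
have lab z : ~~ forbidden b w z -> z <= (asc w).+1 ->
    gap_label_of b (rcons w z) = (size (gap_allowed b (rcons w z)) - 2, Some (minn x z)).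
  move=> fz zA; apply: gap_label_of_repeat; last exact: min_repeat_rcons.
  by rewrite is_ascent_seq_rcons // aw.
have lA := last_le_asc aw.
rewrite /append_children -map_comp {1}gap_allowed_split map_cat map_cons.
rewrite (gap_label_of_repeat _ aw mx) /= size_gap_allowed.
congr (_ ++ _ :: _).
- apply/eq_in_map => z; rewrite mem_iota /= => zx.
  rewrite lab ?gap_allowed_le ?size_gap_allowed ?forbidden_lt_repeat //; try by lia.
  by congr (_, Some _); lia.
- have gl : x <= g <= last 0 w by rewrite /g; case: (b); lia.
  rewrite lab ?gap_allowed_le ?size_gap_allowed ?forbidden_pivot //; try by lia.
  by congr (_, Some _); lia.
have -> : (x + (size F).+1 - 2).+1 - x = size F by lia.
apply: (@eq_from_nth _ (0, None)); rewrite ?size_map ?size_iota // => j jF.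
rewrite (nth_map 0) // (nth_map 0) ?size_iota // nth_iota // add0n /=.
have : nth 0 F j \in F by apply: mem_nth.
rewrite mem_filter mem_iota => /andP[fz zb].
rewrite lab //; last by lia.
rewrite size_gap_allowed_gt // size_gap_allowed; congr (_, Some _); lia.
Qed.

End GapStep.

Lemma gap_labels b w : w != [::] -> is_ascent_seq w && avoids_all (gap_pair b) w ->
  map (gap_label_of b) (append_children (gap_allowed b) w) =
  gap_children (gap_label_of b w).
Proof.
move=> w0 /andP[aw avw]; have [uw|nuw] := boolP (uniq w); last first.
  by have [x mx] := min_repeat_exists aw nuw; apply: gap_labels_repeat mx.
have [n wE] : exists n, w = iota 0 n.+1.
  exists (size w).-1; rewrite {1}(uniq_ascent_seq aw uw).
  by case: (w) w0.
have allowed_iota : gap_allowed b w = iota 0 n.+2.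
  rewrite /gap_allowed wE asc_iota; apply/all_filterP/allP => z _.
  by rewrite forbidden_uniq ?iota_uniq.
rewrite /append_children allowed_iota [in RHS]/gap_label_of uw wE asc_iota.
have -> : gap_children (n, None) = rcons [seq (n, Some z) | z <- iota 0 n.+1] (n.+1, None) by [].
rewrite (iota_rcons 0 n.+1) !map_rcons -map_comp.
have -> : gap_label_of b (rcons (iota 0 n.+1) n.+1) = (n.+1, None).
  by rewrite -iota_rcons /gap_label_of iota_uniq asc_iota.
congr rcons; apply/eq_in_map => z; rewrite mem_iota /= add0n ltnS => zn.
have mz := min_repeat_iota zn.
have az : is_ascent_seq (rcons (iota 0 n.+1) z).
  by rewrite is_ascent_seq_rcons // -wE aw wE asc_iota; lia.
rewrite (gap_label_of_repeat b az mz); congr (_, _).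
rewrite /gap_allowed asc_rcons // asc_iota last_iota ltnNge zn addn0.
rewrite (_ : [seq _ <- _ | _] = iota 0 n.+2) ?size_iota ?subn2 //.
by apply/all_filterP/allP => y _; rewrite forbidden_rcons_uniq ?iota_uniq.
Qed.

(** * Counting the labels of a generation by ballot numbers *)

(** In series, [C = 1 / (1 - x C)] multiplied by [C^a]. *)
Lemma sum_ballot_diag K a : \sum_(e < K.+1) ballot (K - e) (a + e) = ballot K a.+1.
Proof.
elim: K a => [|K IH] a; first by rewrite big_ord1.
rewrite big_ord_recl ballotS -IH; congr (_ + _); first by rewrite subn0 addn0.
by apply: eq_bigr => e _; rewrite lift0 subSS addnS addSn.
Qed.

Lemma sum_eq_count (X : eqType) (L : seq X) t : \sum_(s <- L) (s == t) = count_mem t L.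
Proof. by rewrite -sum1_count [RHS]big_mkcond; apply: eq_bigr => s _ /=; case: eqP. Qed.

Definition gap_count k (t : gap_label) : nat :=
  match t with
  | (M, None) => M == k
  | (M, Some x) => if (x <= M) && (M < k) then ballot (k - M.+1) (M - x).+2 else 0
  end.

Lemma gap_level_bound k s : s \in level gap_children k [:: (0, None)] ->
  match s with (M, None) => M <= k | (M, Some x) => x <= M < k end.
Proof.
elim: k s => [|k IH] s; first by rewrite inE => /eqP ->.
rewrite levelS => /flatten_mapP[[M [x|]] /IH Mx].
  rewrite /= mem_cat inE => /or3P[/mapP[z]|/eqP -> |/mapP[j]]; last 2 first.
  - lia.
  - by rewrite mem_iota => jb ->; lia.
  by rewrite mem_iota => zb ->; lia.
rewrite -[gap_children _]/(rcons [seq (M, Some z) | z <- iota 0 M.+1] (M.+1, None)).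
rewrite mem_rcons inE => /orP[/eqP -> //|/mapP[z]].
by rewrite mem_iota => zb ->; lia.
Qed.

Lemma count_iota_pred (p : pred nat) m n i : (forall j, m <= j < m + n -> p j = (j == i)) ->
  count p (iota m n) = (m <= i < m + n).
Proof.
move=> pE; rewrite (eq_in_count (a2 := pred1 i)).
  by rewrite count_uniq_mem ?iota_uniq // mem_iota.
by move=> j; rewrite mem_iota => /pE.
Qed.

Lemma count_gap_children_None M M' x :
  count_mem (M, Some x) (gap_children (M', None)) = (M' == M) && (x <= M) :> nat.
Proof.
have -> : gap_children (M', None) =
  [seq (M', Some z) | z <- iota 0 M'.+1] ++ [:: (M'.+1, None)] by rewrite cats1.
rewrite count_cat count_map [count_mem _ [:: _]]/= xpair_eqE andbF !addn0.
have [->|ne] := eqVneq M' M.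
  by rewrite (count_iota_pred (i := x)) // => j _; rewrite /= xpair_eqE eqxx.
rewrite (eq_count (a2 := pred0)) ?count_pred0 // => j.
by rewrite /= xpair_eqE (negbTE ne).
Qed.

Lemma count_gap_children_Some M M' x x' : x' <= M' ->
  count_mem (M, Some x) (gap_children (M', Some x')) =
  ((M' == M) && (x <= x')) + ((x' == x) && (x <= M <= M')).
Proof.
move=> xM; have -> : gap_children (M', Some x') =
    [seq (M', Some z) | z <- iota 0 x'.+1] ++ [seq (M' - j, Some x') | j <- iota 0 (M'.+1 - x')].
  by rewrite iota_rcons map_rcons cat_rcons.
rewrite count_cat !count_map; congr (_ + _).
  have [->|ne] := eqVneq M' M.
    by rewrite (count_iota_pred (i := x)) // => j _; rewrite /= xpair_eqE eqxx.
  rewrite (eq_count (a2 := pred0)) ?count_pred0 // => j.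
  by rewrite /= xpair_eqE (negbTE ne).
have [xE|ne] := eqVneq x' x; last first.
  rewrite (eq_count (a2 := pred0)) ?count_pred0 // => j.
  by rewrite /= xpair_eqE -[Some _ == _]/(x' == x) (negbTE ne) andbF.
have [MM|MM] := leqP M M'; last first.
  rewrite andbF (eq_count (a2 := pred0)) ?count_pred0 // => j.
  by rewrite /= xpair_eqE; lia.
rewrite (count_iota_pred (i := M' - M)); first lia.
by move=> j jb; rewrite /= xpair_eqE -[Some _ == _]/(x' == x) xE eqxx andbT; lia.
Qed.

Lemma gap_count0 k M x : (x <= M) && (M < k) = false -> gap_count k (M, Some x) = 0.
Proof. by move=> h; rewrite /= h. Qed.

Lemma sum_ballotS k d : \sum_(i < d.+1) ballot k (d - i).+2 = ballot k.+1 d.+1.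
Proof.
rewrite /= (reindex_inj rev_ord_inj); apply: eq_bigr => i _ /=.
by rewrite subSS subKn // -ltnS.
Qed.

Lemma sum_nat_shift m n (F : nat -> nat) :
  \sum_(m <= i < n) F i = \sum_(i < n - m) F (i + m).
Proof. by rewrite -{1}[m]add0n big_addn big_mkord. Qed.

(** The terms are the possible parents of [(M, Some x)]; a parent with the same label counts in both
    sums, once for the pivot and once for [j = 0]. By [sum_ballotS] and [sum_ballot_diag] the two
    sums are the two terms of [ballotS]. *)
Lemma gap_countS k M x : x <= M -> gap_count k.+1 (M, Some x) =
  (M == k) + \sum_(x <= y < M.+1) gap_count k (M, Some y) +
  \sum_(M <= N < k) gap_count k (N, Some x).
Proof.
move=> xM; rewrite /gap_count xM /=.
have [Mk|kM] := ltnP M k; last first.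
  rewrite [X in _ + X]big_geq // addn0 big1 ?addn0; last by move=> y _; rewrite andbF.
  by have [->|ne] := eqVneq M k; [rewrite ltnSn subnn | rewrite (_ : M < k.+1 = false) //; lia].
rewrite ltnW ?ltnS // ltn_eqF // add0n.
rewrite !sum_nat_shift subSS (subSn xM).
have -> : \sum_(i < (M - x).+1) (if (i + x <= M) && true then ballot (k - M.+1) (M - (i + x)).+2 else 0)
   = \sum_(i < (M - x).+1) ballot (k - M.+1) ((M - x) - i).+2.
  apply: eq_bigr => i _; rewrite ifT; last by have := ltn_ord i; lia.
  by congr ballot; lia.
rewrite sum_ballotS.
have -> : k - M = (k - M.+1).+1 by lia.
set K := k - M.+1.
have -> : \sum_(i < K.+1) (if (x <= i + M) && (i + M < k)
   then ballot (k - (i + M).+1) (i + M - x).+2 else 0) = \sum_(i < K.+1) ballot (K - i) ((M - x).+2 + i).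
  apply: eq_bigr => i _; have := ltn_ord i => iK.
  by rewrite ifT; [congr ballot | ]; rewrite /K in iK *; lia.
by rewrite sum_ballot_diag ballotS.
Qed.

Lemma sum_nat_eq m n a : \sum_(m <= i < n) (i == a) = (m <= a < n).
Proof. by rewrite sum_eq_count count_uniq_mem ?iota_uniq // mem_index_iota. Qed.

Lemma count_gap_level k M x :
  count_mem (M, Some x) (level gap_children k [:: (0, None)]) = gap_count k (M, Some x) /\
  count_mem (M, None) (level gap_children k [:: (0, None)]) = (M == k).
Proof.
elim: k M x => [|k IH] M x.
  split; rewrite /= xpair_eqE ?andbF // eqxx andbT addn0 eq_sym //.
have cnt t : count_mem t (level gap_children k.+1 [:: (0, None)]) =
  \sum_(s <- level gap_children k [:: (0, None)]) count_mem t (gap_children s).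
  by rewrite levelS count_flatten sumnE !big_map.
rewrite !cnt; split.
  have [xM|Mx] := leqP x M; last first.
    rewrite gap_count0; last by lia.
    rewrite big_seq big1 // => -[M' [x'|]] /gap_level_bound sb.
      by rewrite count_gap_children_Some; lia.
    by rewrite count_gap_children_None; lia.
  rewrite gap_countS // -(IH M x).2 -sum_eq_count.
  (* The terms of the recurrence are turned back into sums over the nodes of generation [k]; it then
     remains to compare them, node by node, with the number of children labelled [(M, Some x)]. *)
  rewrite (eq_bigr _ (fun y _ => esym (etrans (sum_eq_count _ _) (IH M y).1))).
  rewrite [X in _ = _ + X](eq_bigr _ (fun N _ => esym (etrans (sum_eq_count _ _) (IH N x).1))).
  rewrite exchange_big [X in _ = _ + X]exchange_big -!big_split.
  apply: eq_big_seq => -[M' [x'|]] /gap_level_bound sb; last first.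
    rewrite [in RHS]/= count_gap_children_None !big1 => [|N _|y _]; rewrite ?xpair_eqE ?andbF //.
    by rewrite xM !andbT !addn0.
  have -> : \sum_(x <= y < M.+1) ((M', Some x') == (M, Some y)) =
      (M' == M) * (x <= x' < M.+1).
    rewrite -sum_nat_eq big_distrr; apply: eq_bigr => y _.
    by rewrite [RHS]/= mulnb xpair_eqE [y == _]eq_sym.
  have -> : \sum_(M <= N < k) ((M', Some x') == (N, Some x)) = (M <= M' < k) * (x' == x).
    rewrite -sum_nat_eq big_distrl; apply: eq_bigr => y _.
    by rewrite [RHS]/= mulnb xpair_eqE [y == _]eq_sym.
  rewrite count_gap_children_Some ?xpair_eqE ?andbF; last by case/andP: sb.
  rewrite /=; do 2!case: eqP => [?|_]; rewrite /= ?muln0 ?muln1 ?mul1n ?mul0n; lia.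
(* Only [(M.-1, None)] has the child [(M, None)]; the factor [0 < M] discards [M = 0], where [M.-1]
   would be 0 again. *)
rewrite (eq_big_seq (fun s => (s == (M.-1, None)) * (0 < M))).
  rewrite -big_distrl /= sum_eq_count (IH _ 0).2.
  by case: M => [|M]; rewrite ?muln0 ?muln1.
move=> [M' o] /gap_level_bound sb; case: o sb => [x'|] sb.
  rewrite xpair_eqE andbF mul0n; apply/count_memPn.
  rewrite /= mem_cat inE !negb_or; apply/and3P; split.
  - by apply/mapP => -[].
  - by rewrite xpair_eqE andbF.
  by apply/mapP => -[].
rewrite -[gap_children _]/(rcons [seq (M', Some z) | z <- iota 0 M'.+1] (M'.+1, None)).
rewrite -cats1 count_cat (_ : count_mem _ (map _ _) = 0); last first.
  by apply/count_memPn/mapP => -[].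
by rewrite /= !xpair_eqE; case: (M) => [|i]; rewrite ?muln0 ?muln1 ?eqSS andbT // addn0.
Qed.

(** Summing over [x] leaves [ballot (k - M) M.+1] for each [M < k], and the node [(k, None)]
    supplies the term 1 for [M = k]. The diagonal sum of these is [ballot k 2]. *)
Lemma size_gap_level k : size (level gap_children k [:: (0, None)]) = catalan k.+1.
Proof.
set L := level _ _ _.
(* Each node is counted as the sum of the indicators of all labels possible in this generation, so
   that the sums can be exchanged. *)
have E s : s \in L -> 1 = \sum_(M < k.+1) (s == (M : nat, None)) +
    \sum_(M < k.+1) \sum_(x < M.+1) (s == (M : nat, Some (x : nat))).
  case: s => [M [x|]] /gap_level_bound sb.
    rewrite big1 ?add0n => [|N _]; last by rewrite xpair_eqE andbF.
    have Mk : M < k.+1 by lia.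
    have xM : x < M.+1 by lia.
    rewrite (bigD1 (Ordinal Mk)) //= (bigD1 (Ordinal xM)) //= eqxx !big1 // => [N ne|y ne].
      rewrite big1 // => y _; rewrite xpair_eqE (negbTE (_ : M != N)) //.
      by apply: contra ne => /eqP MN; apply/eqP/val_inj.
    rewrite xpair_eqE eqxx /= -[Some _ == _]/(x == y :> nat) eq_sym.
    by rewrite -(inj_eq val_inj) in ne; rewrite (negbTE ne).
  have Mk : M < k.+1 by [].
  rewrite (bigD1 (Ordinal Mk)) //= eqxx !big1 // => [N _|N ne].
    by rewrite big1 // => x _; rewrite xpair_eqE andbF.
  rewrite xpair_eqE andbT eq_sym; rewrite -(inj_eq val_inj) in ne.
  by rewrite (negbTE ne).
rewrite -sum1_size (eq_big_seq _ E) big_split /=.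
rewrite exchange_big /=.
have -> : \sum_(M < k.+1) \sum_(s <- L) (s == (M : nat, None)) = 1.
  rewrite big_ord_recr big1 /= => [|M _]; rewrite sum_eq_count (count_gap_level _ _ 0).2 ?eqxx //.
  by rewrite ltn_eqF.
rewrite exchange_big /=.
have S M : \sum_(s <- L) \sum_(x < M.+1) (s == (M, Some (x : nat))) =
    if M < k then ballot (k - M) M.+1 else 0.
  rewrite exchange_big /=; case: ifP => Mk.
    rewrite (_ : k - M = (k - M.+1).+1); last by lia.
    rewrite -sum_ballotS; apply: eq_bigr => x _.
    rewrite sum_eq_count (count_gap_level _ _ _).1 /= Mk andbT ifT //.
    by rewrite -ltnS.
  by rewrite big1 // => x _; rewrite sum_eq_count (count_gap_level _ _ _).1 /= Mk andbF.
rewrite -ballot_catalan -sum_ballot_diag [RHS]big_ord_recr /= subnn /= addnC.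
rewrite big_ord_recr /= S ltnn addn0; congr (_ + _).
by apply: eq_bigr => M _; rewrite S ltn_ord add1n.
Qed.

(** * The pair (0001,1012) *)

Definition rgf_step m x := maxn m x.+1.
(** One more than the maximum, and 0 for the empty word: the largest letter by which restricted
    growth can continue. *)
Definition rgf_bound (w : seq nat) := foldl rgf_step 0 w.

Fixpoint rgf_from m (w : seq nat) :=
  if w is x :: w' then (x <= m) && rgf_from (rgf_step m x) w' else true.

Notation rgf := (rgf_from 0).

Lemma rgf_from_cat m u v :
  rgf_from m (u ++ v) = rgf_from m u && rgf_from (foldl rgf_step m u) v.
Proof. by elim: u m => //= x u IH m; rewrite IH andbA. Qed.

Lemma rgf_rcons w x : rgf (rcons w x) = rgf w && (x <= rgf_bound w).
Proof. by rewrite -cats1 rgf_from_cat /= andbT. Qed.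

Lemma rgf_bound_rcons w x : rgf_bound (rcons w x) = maxn (rgf_bound w) x.+1.
Proof. exact: foldl_rcons. Qed.

Lemma lt_rgf_bound w x : x \in w -> x < rgf_bound w.
Proof.
elim/last_ind: w => // w y IH; rewrite mem_rcons rgf_bound_rcons inE.
by case/predU1P => [->|/IH]; lia.
Qed.

Lemma rgf_mem w x : rgf w -> x < rgf_bound w -> x \in w.
Proof.
elim/last_ind: w => // w y IH; rewrite rgf_rcons rgf_bound_rcons mem_rcons inE.
case/andP=> rw yw xb; have [//|ne] := eqVneq x y.
by apply: IH => //; lia.
Qed.

Lemma rgf_from_small m v : all (fun x => x < m) v -> rgf_from m v.
Proof.
elim: v => //= x v IH /andP[xm vm]; rewrite ltnW //=.
by rewrite /rgf_step (maxn_idPl xm) IH.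
Qed.

(** Once [M] bounds all later letters, restricted growth imposes nothing after it. *)
Lemma rgf_pivot p M r : (forall y, y \in r -> y <= M) ->
  rgf (p ++ M :: r) = rgf p && (M <= rgf_bound p).
Proof.
move=> rM; rewrite -cat_rcons rgf_from_cat -/(rgf_bound _) rgf_rcons.
rewrite (rgf_from_small (v := r)) ?andbT //.
by apply/allP => y /rM; rewrite rgf_bound_rcons; lia.
Qed.

(** * Freeness, avoidance and restricted growth *)

Definition free (w : seq nat) :=
  ~~ has (fun y => has (fun a => (a <= y) && subseq [:: y; a; y] w) w) w.

Definition good (w : seq nat) := avoids_all [:: [:: 0; 0; 0; 1]; [:: 1; 0; 1; 2]] w.

Lemma freePn w : reflect (exists y a, a <= y /\ subseq [:: y; a; y] w) (~~ free w).
Proof.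
rewrite /free negbK; apply: (iffP hasP) => [[y _ /hasP[a _ /andP[ay sub]]]|].
  by exists y, a.
case=> y [a [ay sub]]; exists y; first by rewrite (mem_subseq sub) ?mem_head.
by apply/hasP; exists a; rewrite ?ay // (mem_subseq sub) // !inE eqxx orbT.
Qed.

(* The case [a = y] is 0001, the case [a < y] is 1012. *)
Lemma goodPn w :
  reflect (exists y a c, a <= y < c /\ subseq [:: y; a; y; c] w) (~~ good w).
Proof.
rewrite /good avoids_pair negb_and !negbK; apply: (iffP orP).
  case=> [/contains_0001P[y [c [yc sub]]]|/contains_1012P[a [y [c [ayc sub]]]]].
    by exists y, y, c; rewrite leqnn.
  by exists y, a, c; split=> //; lia.
case=> y [a [c [ayc sub]]]; have [ay|ne] := eqVneq a y.
  by left; apply/contains_0001P; exists y, c; split; [lia | rewrite -{2}ay].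
by right; apply/contains_1012P; exists a, y, c; split=> //; lia.
Qed.

Lemma free_subseq u w : subseq u w -> free w -> free u.
Proof.
move=> uw; apply: contraTT => /freePn[y [a [ay sub]]]; apply/freePn.
by exists y, a; rewrite (subseq_trans sub uw).
Qed.

Lemma good_subseq u w : subseq u w -> good w -> good u.
Proof. exact: avoids_all_subseq. Qed.

Lemma rgf_ascent w : rgf w -> is_ascent_seq w /\ rgf_bound w <= (asc w).+1.
Proof.
elim/last_ind: w => // w x IH; have [->|w0] := eqVneq w [::].
  by rewrite /rgf_bound /= is_ascent_seq1 leqn0 andbT => /eqP ->.
rewrite rgf_rcons is_ascent_seq_rcons // asc_rcons // rgf_bound_rcons.
case/andP=> /IH[-> bw] xw; split; first by lia.
have : last 0 w < rgf_bound w.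
  by apply: lt_rgf_bound; case: (w) w0 => // a v _; apply: mem_last.
lia.
Qed.

(** So many ascents force one that does not raise the bound. It ends in a letter [x] that occurred
    before and differs from the preceding letter [l < x], so [x l x] is an obstruction. *)
Lemma rgf_asc_bound w : rgf w -> w != [::] -> rgf_bound w <= asc w -> ~~ free w.
Proof.
elim/last_ind: w => // w x IH; have [->|w0] := eqVneq w [::].
  by rewrite /rgf_bound /= /rgf_step /asc /= max0n.
rewrite rgf_rcons asc_rcons // rgf_bound_rcons => /andP[rw xw] _ bw.
have up u : ~~ free w -> ~~ free (rcons w u).
  by apply: contra; apply: free_subseq; apply: subseq_rcons.
have [lx|xl] := ltnP (last 0 w) x; last by apply/up/IH => //; lia.
have [xb|bx] := ltnP x (rgf_bound w); last by apply/up/IH => //; lia.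
apply/freePn; exists x, (last 0 w); split; first exact: ltnW.
rewrite (subseq_rcons_rcons [:: x; last 0 w]) eqxx.
case/lastP: w w0 rw xb lx {IH xw bw up} => // v l _ rw xb; rewrite last_rcons => lx.
rewrite (subseq_rcons_rcons [:: x]) eqxx sub1seq.
have := rgf_mem rw xb; rewrite mem_rcons inE => /orP[/eqP|//]; lia.
Qed.

(** A letter above the bound is legal only if there are at least [rgf_bound w] ascents. Then [w] is
    not free, and the obstruction [y a y] is followed by a letter above [y]. *)
Lemma ascent_rgf w : is_ascent_seq w -> good w -> rgf w.
Proof.
elim/last_ind: w => // w x IH; have [->|w0] := eqVneq w [::].
  by rewrite is_ascent_seq1 => /eqP ->.
rewrite is_ascent_seq_rcons // rgf_rcons => /andP[aw xle] gw.
have rw : rgf w by apply: IH => //; apply: good_subseq gw; apply: subseq_rcons.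
rewrite rw /= leqNgt; apply: contraL gw => bx; apply/goodPn.
have /freePn[y [a [ay sub]]] : ~~ free w by apply: rgf_asc_bound => //; lia.
exists y, a, x; split.
  have : y < rgf_bound w by apply: lt_rgf_bound; rewrite (mem_subseq sub) ?mem_head.
  lia.
by rewrite (subseq_rcons_rcons [:: y; a; y]) eqxx.
Qed.

Lemma ascent_good w : is_ascent_seq w && good w = rgf w && good w.
Proof.
by apply/andP/andP => -[h g]; split=> //; [exact: ascent_rgf | case: (rgf_ascent h)].
Qed.

(** * Inserting a maximal letter *)

Lemma subseq_insert (T : eqType) (t u v : seq T) N : N \notin t ->
  subseq t (u ++ N :: v) = subseq t (u ++ v).
Proof.
move=> Nt; apply/idP/idP => sub; last first.
  by apply: subseq_trans sub _; apply: cat_subseq => //; apply: subseq_cons.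
have : subseq t [seq x <- u ++ N :: v | x != N].
  by rewrite subseq_filter sub andbT; apply/allP => x xt; apply: contraNneq Nt => <-.
move/subseq_trans; apply; rewrite filter_cat /= eqxx -filter_cat.
exact: filter_subseq.
Qed.

Lemma subseq_drop_insert (T : eqType) (u v : seq T) N : subseq (u ++ v) (u ++ N :: v).
Proof. by apply: cat_subseq => //; apply: subseq_cons. Qed.

Lemma subseq_rcons_insert (T : eqType) (t u v : seq T) N : N \notin t ->
  subseq (rcons t N) (u ++ N :: v) -> subseq t u \/ subseq (rcons t N) (u ++ v).
Proof.
move=> Nt; elim/last_ind: v => [|v x IH].
  by rewrite cats1 subseq_rcons_rcons eqxx; left.
rewrite -rcons_cons -!rcons_cat !subseq_rcons_rcons; case: eqP => _.
  by rewrite subseq_insert //; right.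
by case/IH; [left | right].
Qed.

(** The inserted maximum could only play [c] in a forbidden [y a y c]. Then [y a y] lies in the free
    word [u], or another copy of [N] can play [c]. *)
Lemma good_insert u v N : (forall y, y \in u ++ v -> y <= N) -> free u ->
  good (u ++ v) -> good (u ++ N :: v).
Proof.
move=> leN fu guv; apply: contraT => /goodPn[y [a [c [ayc sub]]]].
have cN : c <= N.
  have : c \in u ++ N :: v by rewrite (mem_subseq sub) // !inE eqxx !orbT.
  by rewrite mem_cat inE orbCA -mem_cat => /orP[/eqP ->|/leN].
have Nt : N \notin [:: y; a; y] by rewrite !inE; lia.
have [cE|ne] := eqVneq c N; last first.
  suff : ~~ good (u ++ v) by rewrite guv.
  apply/goodPn; exists y, a, c; split=> //.
  by move: sub; rewrite subseq_insert // !inE; lia.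
move: sub; rewrite cE -[[:: y; a; y; N]]/(rcons [:: y; a; y] N).
case/(subseq_rcons_insert Nt) => sub.
  suff : ~~ free u by rewrite fu.
  by apply/freePn; exists y, a; split=> //; lia.
suff : ~~ good (u ++ v) by rewrite guv.
by apply/goodPn; exists y, a, N; split=> //; lia.
Qed.

(** A strict maximum occurs once, so in [y a y] with [a <= y] it can be neither [y] nor [a]. *)
Lemma free_insert_max u v N : (forall y, y \in u ++ v -> y < N) ->
  free (u ++ N :: v) = free (u ++ v).
Proof.
move=> ltN; apply/idP/idP; first by apply: free_subseq; apply: subseq_drop_insert.
apply: contraTT => /freePn[y [a [ay sub]]]; apply/freePn; exists y, a; split=> //.
have Nuv : N \notin u ++ v by apply/negP => /ltN; lia.
have yN : y != N.
  apply/eqP => yE; move: Nuv; rewrite -has_pred1 has_count -leqNgt leqn0 => /eqP c0.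
  have := leq_count_subseq (pred1 N) sub; rewrite count_cat /= yE eqxx.
  by move/eqP: c0; rewrite count_cat addn_eq0 => /andP[/eqP -> /eqP ->]; case: (a == N).
have : y \in u ++ N :: v by rewrite (mem_subseq sub) ?mem_head.
rewrite mem_cat inE orbCA -mem_cat (negbTE yN) /= => /ltN yltN.
by rewrite -(subseq_insert _ _ (N := N)) // !inE; lia.
Qed.

(** * Nodes of the insertion tree and their children *)

Definition node : eqType := (seq nat * nat * seq nat * seq nat * bool)%type.

Definition node_word (n : node) := let: (p, M, s, t, f) := n in p ++ M :: s ++ t.

(* [M] is the maximum, [p] stops before its first occurrence, [p ++ M :: s] is the
   longest free prefix, and [f] tells whether [M] occurs only once. *)
Definition node_inv (n : node) := let: (p, M, s, t, f) := n in
  [/\ (forall y, y \in p -> y < M) /\ (forall y, y \in s ++ t -> y <= M),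
      free (p ++ M :: s), t = [::] \/ ~~ free (p ++ M :: s ++ [:: head 0 t]),
      f = (M \notin s ++ t) & rgf (node_word n) && good (node_word n)].

(** In turn: a new maximum after the first [i] letters of [s]; a copy of [M] there, where [i > 0]
    makes it end the free prefix; a copy of [M] next to its only occurrence, which leaves the prefix
    free. *)
Definition node_children (n : node) : seq node := let: (p, M, s, t, f) := n in
  [seq (p ++ M :: take i s, M.+1, drop i s, t, true) | i <- iota 0 (size s).+1] ++
  [seq (p, M, take i s, M :: drop i s ++ t, false) | i <- iota 1 (size s)] ++
  (if f then [:: (p, M, M :: s, t, false)] else [::]).

Lemma subseq_cons_prefix (T : eqType) (p s : seq T) x y : subseq (p ++ x :: s) (p ++ x :: s ++ y).
Proof. by rewrite -cat_cons catA prefix_subseq. Qed.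

Lemma mem_head_seq (T : eqType) (x : T) t : t <> [::] -> head x t \in t.
Proof. by case: t => // y t _; apply: mem_head. Qed.

Lemma node_inv_new p M s1 s2 t f : node_inv (p, M, s1 ++ s2, t, f) ->
  node_inv (p ++ M :: s1, M.+1, s2, t, true).
Proof.
case=> -[pM stM] fr tfr _ /andP[rw gw].
have leM y : y \in (p ++ M :: s1) ++ s2 ++ t -> y <= M.
  rewrite -catA cat_cons catA mem_cat inE.
  by case/or3P => [/pM/ltnW|/eqP ->|/stM].
have ltM1 y u v : y \in u ++ v -> subseq (u ++ v) ((p ++ M :: s1) ++ s2 ++ t) -> y < M.+1.
  by move=> yuv /mem_subseq /(_ y yuv) /leM.
have sub2 : subseq ((p ++ M :: s1) ++ s2) ((p ++ M :: s1) ++ s2 ++ t).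
  by rewrite catA prefix_subseq.
rewrite /node_inv; split.
- split=> y yin; [rewrite ltnS | apply: leqW]; apply: leM; rewrite mem_cat yin ?orbT //.
- rewrite free_insert_max; first by rewrite -catA.
  by move=> y /(mem_subseq sub2) /leM.
- case: tfr => [->|nf]; first by left.
  have [->|t0] := eqVneq t [::]; first by left.
  right; rewrite free_insert_max; first by move: nf; rewrite -!catA cat_cons.
  move=> y; rewrite catA mem_cat inE => /orP[/(mem_subseq sub2)/leM //|/eqP ->].
  by rewrite ltnS; apply: stM; rewrite mem_cat mem_head_seq ?orbT //; apply/eqP.
- apply/esym/negP => M1; have : M.+1 <= M by apply: leM; rewrite mem_cat M1 orbT.
  by rewrite ltnn.
rewrite /node_word rgf_pivot; last first.
  by move=> y yin; apply/leqW/leM; rewrite mem_cat yin orbT.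
apply/andP; split; last first.
  apply: good_insert; first by move=> y /leM/leqW.
    by apply: free_subseq fr; rewrite subseq_cons_prefix.
  by move: gw; rewrite /node_word -!catA cat_cons.
rewrite lt_rgf_bound ?mem_cat ?mem_head ?orbT // andbT.
by move: rw; rewrite /node_word -catA -cat_cons catA rgf_from_cat => /andP[].
Qed.

Lemma node_inv_trig p M s1 s2 t f : s1 != [::] -> node_inv (p, M, s1 ++ s2, t, f) ->
  node_inv (p, M, s1, M :: s2 ++ t, false).
Proof.
move=> s10 [[pM stM] fr _ _ /andP[rw gw]].
have stM' y : y \in s1 ++ M :: s2 ++ t -> y <= M.
  by rewrite mem_cat inE orbCA -mem_cat => /orP[/eqP -> //|yin]; apply: stM; rewrite -catA.
have fs1 : free (p ++ M :: s1) by apply: free_subseq fr; apply: subseq_cons_prefix.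
split=> //.
- right; apply/freePn; case: s1 s10 stM' {fr fs1 rw gw stM} => // a s1 _ stM.
  exists M, a; split; first by apply: stM; rewrite mem_head.
  apply: subseq_trans (suffix_subseq _ _); rewrite /= !eqxx sub1seq.
  by rewrite mem_cat inE eqxx orbT.
- by rewrite mem_cat mem_head orbT.
apply/andP; split.
  rewrite /node_word rgf_pivot //; move: rw; rewrite /node_word rgf_pivot //.
rewrite /node_word -cat_cons catA; apply: good_insert => //.
  move=> y; rewrite -catA mem_cat cat_cons inE => /or3P[/pM/ltnW|/eqP ->|] // yin.
  by apply: stM; rewrite -catA.
by move: gw; rewrite /node_word -!catA cat_cons.
Qed.

Lemma subseq_cat_notin (T : eqType) (p r t : seq T) x : x \notin p ->
  subseq (x :: t) (p ++ r) = subseq (x :: t) r.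
Proof.
elim: p => // y p IH; rewrite inE negb_or => /andP[xy xp].
by rewrite cat_cons [LHS]/= (negbTE xy) -[RHS]IH.
Qed.

Lemma node_inv_adj p M s t : node_inv (p, M, s, t, true) ->
  node_inv (p, M, M :: s, t, false).
Proof.
case=> -[pM stM] fr tfr /esym Mst /andP[rw gw].
have stM' y : y \in (M :: s) ++ t -> y <= M.
  by rewrite inE => /predU1P[-> //|/stM].
have Mp : M \notin p by apply/negP => /pM; rewrite ltnn.
have Ms : M \notin s by apply: contra Mst => Ms; rewrite mem_cat Ms.
split=> //.
- apply: contraTT fr => /freePn[y [a [ay sub]]]; apply/freePn.
  have [yM|yM] := eqVneq y M.
    move: sub ay; rewrite yM subseq_cat_notin // [subseq _ _]/= eqxx.
    have [->|aM] := eqVneq a M; first by rewrite sub1seq (negbTE Ms).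
    by move=> /mem_subseq /(_ M); rewrite !inE eqxx orbT (negbTE Ms) => /(_ isT).
  have yltM : y < M.
    rewrite ltn_neqAle yM /=; have : y \in p ++ M :: M :: s by rewrite (mem_subseq sub) ?mem_head.
    rewrite mem_cat inE => /or3P[/pM/ltnW|/eqP ->|yin] //.
    by apply: stM'; rewrite mem_cat yin.
  exists y, a; split=> //; move: sub.
  by rewrite -cat_rcons subseq_insert ?cat_rcons // !inE; lia.
- case: tfr => [->|nf]; [by left | right].
  apply: contra nf; apply: free_subseq; apply: cat_subseq => //.
  exact: (subseq_cons (M :: _)).
- by rewrite mem_head.
apply/andP; split.
  by rewrite /node_word rgf_pivot //; move: rw; rewrite /node_word rgf_pivot.
rewrite /node_word -cat_rcons; apply: good_insert.
- by move=> y; rewrite cat_rcons mem_cat inE => /or3P[/pM/ltnW|/eqP ->|/stM].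
- by apply: free_subseq fr; rewrite -cat_rcons prefix_subseq.
by rewrite cat_rcons.
Qed.

(** * Every word comes from a node, and every node but the root has a parent *)

Lemma split_free u r : free u -> exists s t, [/\ r = s ++ t, free (u ++ s) &
  t = [::] \/ ~~ free (u ++ s ++ [:: head 0 t])].
Proof.
elim: r u => [|x r IH] u fu; first by exists [::], [::]; rewrite !cats0; split=> //; left.
have [fux|nf] := boolP (free (rcons u x)); last first.
  by exists [::], (x :: r); rewrite cats0 /= cats1; split=> //; right.
have [s [t [-> fs nt]]] := IH _ fux; exists (x :: s), t.
by move: fs nt; rewrite !cat_rcons.
Qed.

Lemma free_rcons_last u h y a : free u -> subseq [:: y; a; y] (rcons u h) -> a <= y ->
  y = h /\ subseq [:: y; a] u.
Proof.
move=> fu; rewrite (subseq_rcons_rcons [:: y; a]); case: eqP => [-> //|_ sub ay].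
suff : ~~ free u by rewrite fu.
by apply/freePn; exists y, a.
Qed.

(** An obstruction before the first maximum would be followed by a larger letter. *)
Lemma good_free_before_max p M r : good (p ++ M :: r) -> (forall y, y \in p -> y < M) ->
  free (p ++ [:: M]).
Proof.
move=> gw pM; rewrite free_insert_max ?cats0 //.
apply: contraTT gw => /freePn[y [a [ay sub]]]; apply/goodPn; exists y, a, M; split.
  by rewrite ay pM // (mem_subseq sub) ?mem_head.
by apply: (@cat_subseq _ [:: y; a; y] [:: M]); rewrite // sub1seq mem_head.
Qed.

Lemma max_letter (w : seq nat) : w != [::] ->
  exists M, M \in w /\ forall y, y \in w -> y <= M.
Proof.
elim: w => // x w IH _; have [->|/IH[M [Mw wM]]] := eqVneq w [::].
  by exists x; rewrite mem_head; split=> // y; rewrite inE => /eqP ->.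
exists (maxn x M); split.
  by rewrite inE; case: (leqP x M) => _; rewrite ?Mw ?eqxx ?orbT.
by move=> y; rewrite inE => /predU1P[->|/wM]; lia.
Qed.

Lemma node_of_word w : w != [::] -> rgf w && good w ->
  exists2 n, node_inv n & node_word n = w.
Proof.
move=> /max_letter[M [/first_occurrence[p [r [wE Mp]]] wM]] /andP[rw gw].
have pM y : y \in p -> y < M.
  move=> yp; rewrite ltn_neqAle wM ?wE ?mem_cat ?yp // andbT.
  by apply: contraNneq Mp => <-.
have fp : free (p ++ [:: M]) by apply: (good_free_before_max (r := r)) pM; rewrite -wE.
have [s [t [rE fs nt]]] := split_free r fp.
have wE' : p ++ M :: s ++ t = w by rewrite wE rE.
exists (p, M, s, t, M \notin s ++ t) => //=; split=> //.
- by split=> // y yin; apply: wM; rewrite -wE' mem_cat inE yin !orbT.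
- by move: fs; rewrite -catA.
- by case: nt => [|nt]; [left | right; move: nt; rewrite -catA].
by rewrite wE' rw.
Qed.

(** Undoes the first insertion. By restricted growth the predecessor [N] of the only maximum occurs
    in [p], and its first occurrence becomes the new pivot. *)
Lemma node_parent_new p M s t : node_inv (p, M, s, t, true) ->
  1 < size (node_word (p, M, s, t, true)) ->
  exists q N s1 f, [/\ p = q ++ N :: s1, M = N.+1 & node_inv (q, N, s1 ++ s, t, f)].
Proof.
case=> -[pM stM] fr tfr /esym Mst /andP[rw gw] szw.
have stM' y : y \in s ++ t -> y < M.
  by move=> yin; rewrite ltn_neqAle stM // andbT; apply: contraNneq Mst => <-.
case: M => [|N] in pM stM fr tfr Mst rw gw szw stM' *.
  (* If the only maximum were 0, the word would have length 1. *)
  case: p pM szw {fr tfr rw gw} => [|y p] pM /=; last by have := pM y (mem_head _ _).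
  by case: (s ++ t) stM' => // y v /(_ y (mem_head _ _)).
move: rw; rewrite /node_word rgf_pivot // => /andP[rp bp].
have [q [s1 [pE Nq]]] := first_occurrence (rgf_mem rp bp).
exists q, N, s1, (N \notin (s1 ++ s) ++ t).
have qN y : y \in q -> y < N.
  move=> yq; have : y < N.+1 by apply: pM; rewrite pE mem_cat yq.
  by rewrite ltnS leq_eqVlt => /predU1P[yN|//]; rewrite -yN yq in Nq.
have s1stN y : y \in (s1 ++ s) ++ t -> y <= N.
  rewrite -catA mem_cat => /orP[ys1|/stM' //].
  by apply: pM; rewrite pE mem_cat inE ys1 !orbT.
split=> //; split=> //.
- by apply: free_subseq fr; rewrite -cat_cons catA -pE subseq_drop_insert.
- case: tfr => [|nf]; [by left|]; have [->|t0] := eqVneq t [::]; first by left.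
  right; move: nf; rewrite free_insert_max; first by rewrite pE -!catA cat_cons.
  move=> y; rewrite mem_cat => /orP[/pM //|]; rewrite mem_cat inE => yin.
  apply: stM'; rewrite mem_cat; case/orP: yin => [-> //|/eqP ->].
  by rewrite mem_head_seq ?orbT //; apply/eqP.
apply/andP; split.
  move: rp; rewrite /node_word pE !rgf_pivot // => y ys1.
  by apply: s1stN; rewrite -catA mem_cat ys1.
apply: good_subseq gw; rewrite /node_word pE -!catA !cat_cons.
by apply: cat_subseq => //; rewrite /= eqxx; apply: subseq_drop_insert.
Qed.

(** Undoes the second insertion; without this copy of [M] the free prefix may extend by some [s2].
    If [s] were empty, the copy would be adjacent to the first [M] and could not end the free
    prefix. *)
Lemma node_parent_trig p M s t : node_inv (p, M, s, M :: t, false) ->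
  s != [::] /\ exists s2 t' f, t = s2 ++ t' /\ node_inv (p, M, s ++ s2, t', f).
Proof.
case=> -[pM stM] fr [//|nf] _ /andP[rw gw]; split.
  apply: contraNneq nf => s0; rewrite s0 in fr *.
  apply: contraT => /freePn[y [a [ay sub]]]; move: (sub).
  rewrite /= -cat_rcons cats1 => /free_rcons_last[] //.
    by rewrite -cats1.
  move=> yM; rewrite yM -cats1 subseq_cat_notin.
    by rewrite /= eqxx.
  by apply/negP => /pM; rewrite ltnn.
have [s2 [t' [tE fs nt]]] := split_free t fr.
exists s2, t', (M \notin (s ++ s2) ++ t'); split=> //; split=> //.
- split=> // y yin; apply: stM; move: yin.
  by rewrite tE -catA !mem_cat inE !mem_cat => /or3P[]->; rewrite ?orbT.
- by move: fs; rewrite -catA.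
- by case: nt => [|nt]; [left | right; move: nt; rewrite -!catA].
have sub : subseq (p ++ M :: (s ++ s2) ++ t') (p ++ M :: s ++ M :: t).
  rewrite tE -catA; apply: cat_subseq => //; rewrite [subseq _ _]/= eqxx.
  exact: subseq_drop_insert.
apply/andP; split; last exact: good_subseq gw.
move: rw; rewrite /node_word !rgf_pivot // => y yin; apply: stM; move: yin.
by rewrite tE -catA !mem_cat inE !mem_cat => /or3P[]->; rewrite ?orbT.
Qed.

(** Undoes the third insertion. The default [M.+1] places an empty [t] in this case. If [t] begins
    with [h < M], then [h] completes an obstruction, so no [M] follows. The second [M] thus lies in
    [s], and freeness makes it the first letter there and forbids a third. *)
Lemma node_parent_adj p M s t : node_inv (p, M, s, t, false) -> head M.+1 t != M ->
  exists s', s = M :: s' /\ node_inv (p, M, s', t, true).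
Proof.
case=> -[pM stM] fr tfr Mst /andP[rw gw] htM.
have tP h t' : t = h :: t' -> exists a, [/\ a <= h, h < M, M \notin t' &
    subseq [:: h; a; h] (rcons (p ++ M :: s) h)].
  move=> tE; move: htM tfr; rewrite tE /= => hM [//|/freePn[y [a [ay]]]].
  rewrite -cat_cons catA cats1 => sub; have [yh suby] := free_rcons_last fr sub ay.
  subst y; have hltM : h < M.
    by rewrite ltn_neqAle hM stM // tE mem_cat mem_head orbT.
  exists a; split=> //; apply: contraL gw => Mt'.
  apply/goodPn; exists h, a, M; split; first by rewrite ay.
  rewrite /node_word tE -cat_cons catA -cat_rcons.
  by apply: (@cat_subseq _ [:: h; a; h] [:: M]); rewrite // sub1seq.
have Mt : M \notin t.
  case E: t => [//|h t']; have [a [_ hM Mt' _]] := tP _ _ E.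
  by rewrite inE negb_or Mt' andbT gtn_eqF.
have /first_occurrence[s1 [s2 [sE Ms1]]] : M \in s.
  by move: Mst; rewrite mem_cat (negbTE Mt) orbF => /esym/negPn.
have {Ms1} s10 : s1 = [::].
  case: s1 sE Ms1 => // a s1 sE _; suff : ~~ free (p ++ M :: s) by rewrite fr.
  apply/freePn; exists M, a; split; first by apply: stM; rewrite sE mem_head.
  apply: subseq_trans (suffix_subseq _ _); rewrite sE /= !eqxx sub1seq.
  by rewrite mem_cat mem_head orbT.
rewrite s10 /= in sE; exists s2; split=> //.
have Ms2 : M \notin s2.
  apply/negP => Ms2; suff : ~~ free (p ++ M :: s) by rewrite fr.
  apply/freePn; exists M, M; split=> //.
  by apply: subseq_trans (suffix_subseq _ _); rewrite sE /= !eqxx sub1seq.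
have sub : subseq (p ++ M :: s2 ++ t) (p ++ M :: s ++ t).
  by rewrite sE; apply: cat_subseq => //; apply: (subseq_cons (M :: _)).
have stM' y : y \in s2 ++ t -> y <= M by move=> yin; apply: stM; rewrite sE inE yin orbT.
split=> //.
- by apply: free_subseq fr; rewrite sE; apply: cat_subseq => //; apply: (subseq_cons (M :: _)).
- case E: t => [|h t']; [by left | right]; have [a [ah hM _ sub']] := tP _ _ E.
  apply/freePn; exists h, a; split=> //=; move: sub'.
  rewrite rcons_cat rcons_cons sE -cat_rcons rcons_cons subseq_insert ?cat_rcons ?cats1 //.
  by rewrite !inE; lia.
- by rewrite mem_cat negb_or Ms2.
apply/andP; split; last exact: good_subseq gw.
by move: rw; rewrite /node_word !rgf_pivot.
Qed.

(** * Generations of the insertion tree *)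

Definition node_root : node := ([::], 0, [::], [::], true).

Lemma node_childrenP p M s t (f : bool) z :
  reflect [\/ exists s1 s2, s = s1 ++ s2 /\ z = (p ++ M :: s1, M.+1, s2, t, true),
              exists s1 s2, [/\ s = s1 ++ s2, s1 != [::] &
                             z = (p, M, s1, M :: s2 ++ t, false)] |
              f /\ z = (p, M, M :: s, t, false)]
          (z \in node_children (p, M, s, t, f)).
Proof.
rewrite /node_children !mem_cat; apply: (iffP or3P) => -[].
- case/mapP=> i _ ->; constructor 1; exists (take i s), (drop i s).
  by rewrite cat_take_drop.
- case/mapP=> i; rewrite mem_iota => ib ->; constructor 2.
  exists (take i s), (drop i s); rewrite cat_take_drop -size_eq0 size_take_min.
  by split=> //; lia.
- by case: f => //; rewrite inE => /eqP ->; constructor 3.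
- case=> s1 [s2 [-> ->]]; constructor 1; apply/mapP; exists (size s1).
    by rewrite mem_iota size_cat leq0n add0n ltnS leq_addr.
  by rewrite take_size_cat // drop_size_cat.
- case=> s1 [s2 [-> s10 ->]]; constructor 2; apply/mapP; exists (size s1).
    by rewrite mem_iota size_cat lt0n size_eq0 s10 add1n ltnS leq_addr.
  by rewrite take_size_cat // drop_size_cat.
by case=> -> ->; constructor 3; rewrite mem_head.
Qed.

Lemma node_inv_children n z : node_inv n -> z \in node_children n -> node_inv z.
Proof.
case: n => [[[[p M] s] t] f] ni /node_childrenP[].
- by case=> s1 [s2 [sE ->]]; rewrite sE in ni; apply: node_inv_new ni.
- by case=> s1 [s2 [sE s10 ->]]; rewrite sE in ni; apply: node_inv_trig ni.
by case=> fE ->; rewrite fE in ni; apply: node_inv_adj.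
Qed.

Lemma size_node_children n z : z \in node_children n ->
  size (node_word z) = (size (node_word n)).+1.
Proof.
case: n => [[[[p M] s] t] f] /node_childrenP[[s1 [s2 [-> ->]]]|[s1 [s2 [-> _ ->]]]|[_ ->]];
  rewrite /= !size_cat /= !size_cat /= ?size_cat; lia.
Qed.

Lemma node_parent z : node_inv z -> 1 < size (node_word z) ->
  exists2 n, node_inv n & z \in node_children n.
Proof.
case: z => [[[[p M] s] t] []] ni szz.
  have [q [N [s1 [f [pE ME nq]]]]] := node_parent_new ni szz.
  exists (q, N, s1 ++ s, t, f) => //; apply/node_childrenP; constructor 1.
  by exists s1, s; rewrite pE ME.
have [hM|] := eqVneq (head M.+1 t) M; last first.
  move=> htM; have [s' [sE ns']] := node_parent_adj ni htM.
  by exists (p, M, s', t, true) => //; apply/node_childrenP; constructor 3; rewrite sE.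
have [t2 tE] : exists t2, t = M :: t2.
  by case: (t) hM => [/= E|h t2 /= ->]; [exfalso; lia | exists t2].
rewrite tE in ni *; have [s0 [s2 [t' [f [t2E nq]]]]] := node_parent_trig ni.
exists (p, M, s ++ s2, t', f) => //; apply/node_childrenP; constructor 2.
by exists s, s2; rewrite t2E.
Qed.

Lemma node_inv_root : node_inv node_root.
Proof.
split=> //; first by left.
by apply: contraT => /goodPn[y [a [c [_ /size_subseq]]]].
Qed.

Lemma mem_node_level k n : n \in level node_children k [:: node_root] <->
  node_inv n /\ size (node_word n) = k.+1.
Proof.
elim: k n => [|k IH] n.
  rewrite inE; split=> [/eqP -> |].
    by split=> //; apply: node_inv_root.
  case: n => [[[[p M] s] t] f] [[_ _ _ fE /andP[rw _]]] /=.
  rewrite size_cat /= size_cat addnS => -[/eqP].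
  rewrite !addn_eq0 !size_eq0 => /and3P[/eqP p0 /eqP s0 /eqP t0].
  by move: rw; rewrite fE p0 s0 t0 /= leqn0 andbT => /eqP ->.
rewrite levelS; split=> [/flatten_mapP[m /IH[im szm] nm]|[ni szn]].
  by split; [apply: node_inv_children nm | rewrite (size_node_children nm) szm].
have [|m mi nm] := node_parent ni; first by rewrite szn.
apply/flatten_mapP; exists m => //; apply/IH; split=> //.
by have := size_node_children nm; rewrite szn => -[].
Qed.

(** The maximum and its first occurrence fix [M] and [p]. Of two different values of [s], the longer
    would contain the letter that breaks freeness after the shorter. *)
Lemma node_word_inj m n : node_inv m -> node_inv n -> node_word m = node_word n -> m = n.
Proof.
case: m n => [[[[p M] s] t] f] [[[[q N] s'] t'] g].
case=> -[pM stM] fr tfr fE _ [[qN stN] frq tfrq gE _] /= wE.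
have MN : M = N.
  apply/eqP; rewrite eqn_leq; apply/andP; split.
    have : M \in q ++ N :: s' ++ t' by rewrite -wE mem_cat mem_head orbT.
    by rewrite mem_cat inE => /or3P[/qN/ltnW|/eqP ->|/stN].
  have : N \in p ++ M :: s ++ t by rewrite wE mem_cat mem_head orbT.
  by rewrite mem_cat inE => /or3P[/pM/ltnW|/eqP ->|/stM].
subst N; have Mp : M \notin p by apply/negP => /pM; rewrite ltnn.
have Mq : M \notin q by apply/negP => /qN; rewrite ltnn.
have := introT eqP wE; rewrite (eqseq_pivot2l _ _ Mp Mq) => /andP[/eqP pq /eqP stE]; subst q.
have le u v u' v' : free (p ++ M :: u') -> u ++ v = u' ++ v' ->
    v = [::] \/ ~~ free (p ++ M :: u ++ [:: head 0 v]) -> size u' <= size u.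
  move=> fu' uvE nf; rewrite leqNgt; apply/negP => lt.
  case: nf => [v0|/negP[]].
    by have := congr1 size uvE; rewrite v0 cats0 size_cat; lia.
  apply: free_subseq fu'; apply: cat_subseq => //; rewrite [subseq _ _]/= eqxx.
  have -> : u' = u ++ take (size u' - size u) v.
    have := congr1 (take (size u')) uvE.
    by rewrite take_cat ltnNge (ltnW lt) /= take_size_cat // => <-.
  apply: cat_subseq => //; rewrite sub1seq.
  have : 0 < size v.
    by have := congr1 size uvE; rewrite !size_cat; lia.
  by case: v {uvE} => // x v _; rewrite -(subnSK lt) mem_head.
have szs : size s = size s'.
  apply/eqP; rewrite eqn_leq (le _ _ _ _ fr (esym stE) tfrq).
  by rewrite (le _ _ _ _ frq stE tfr).
move/eqP: stE; rewrite eqseq_cat // => /andP[/eqP sE /eqP tE].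
by rewrite fE gE sE tE.
Qed.

(** A child shows which insertion produced it, hence which letter to delete. Second and third
    insertions cannot be confused: the third requires that [M] is absent from [t], while the second
    puts it there. *)
Lemma node_children_word m n z : node_inv m -> node_inv n ->
  z \in node_children m -> z \in node_children n -> node_word m = node_word n.
Proof.
case: m n => [[[[p M] s] t] f] [[[[q N] s'] t'] g] mi ni.
have wordE (p1 s1 s2 t1 : seq nat) K :
  p1 ++ K :: (s1 ++ s2) ++ t1 = (p1 ++ K :: s1) ++ s2 ++ t1 by rewrite -!catA.
have [[pM stM] _ _ fE _] := mi; have [[qN stN] _ _ gE _] := ni.
case/node_childrenP=> [[s1 [s2 [sE ->]]]|[s1 [s2 [sE s10 ->]]]|[ft ->]];
case/node_childrenP=> [[u1 [u2 [uE]]]|[u1 [u2 [uE u10]]]|[gt]] // E.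
- by case: E => E1 MN E2 E3; subst s2 t' N; rewrite /= sE uE !wordE E1.
- by case: E => E1 E2 E3 _ E4; subst q N u1; rewrite /= sE uE !wordE E4.
- case: E => -> -> E1 E2; move: gE; rewrite gt -E2.
  by rewrite mem_cat mem_head orbT.
- case: E => _ MN _ tE; subst N; move: fE; rewrite ft tE.
  by rewrite mem_cat mem_head orbT.
- by case: E => pE ME _ sE tE; rewrite /= pE ME sE tE.
Qed.

Lemma uniq_node_children n : uniq (node_children n).
Proof.
case: n => [[[[p M] s] t] f]; rewrite /node_children !cat_uniq.
have tN : M <> M.+1 by lia.
apply/and4P; split; last 1 first.
- apply/andP; split; last by case: f.
  apply/hasPn => z; case: f => //; rewrite inE => /eqP ->; apply/mapP => -[i].
  by rewrite mem_iota => ib [/(congr1 size)]; rewrite /= size_take_min; lia.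
- rewrite map_inj_in_uniq ?iota_uniq // => i j; rewrite !mem_iota => ib jb.
  by case=> _ /(congr1 size); rewrite !size_drop; lia.
- apply/hasPn => z; rewrite mem_cat => zin; apply/mapP => -[i _ zE].
  case/orP: zin; first by case/mapP=> j _; rewrite zE => -[_ /esym].
  by case: f => //; rewrite inE zE => /eqP[_ /esym].
rewrite map_inj_in_uniq ?iota_uniq // => i j; rewrite !mem_iota => ib jb.
by case=> /(congr1 size) + _; rewrite !size_take_min; lia.
Qed.

Lemma uniq_node_level k : uniq (level node_children k [:: node_root]).
Proof.
elim: k => // k IH; rewrite levelS; apply: uniq_flatten_children => //.
  by move=> n _; apply: uniq_node_children.
move=> m n /mem_node_level[im _] /mem_node_level[jn _] z zm zn.
by apply: node_word_inj => //; apply: node_children_word zm zn.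
Qed.

Definition node_label (n : node) :=
  let: (p, M, s, t, f) := n in if f then (size s).*2.+2 else (size s).*2.+1.

(** The even and odd labels together are [2, 3, .., 2a + 2], each once, as the Catalan rule
    prescribes for [2a + 1]. *)
Lemma sum_ballot_children k a :
  \sum_(i < a.+1) ballot k i.*2.+2 + \sum_(i < a) ballot k i.*2.+3 =
  ballot k.+1 a.*2.+1.
Proof.
elim: a => [|a IH]; first by rewrite big_ord1 big_ord0 addn0 /= big_ord1.
rewrite big_ord_recr [X in _ + X]big_ord_recr addnACA IH doubleS !(ballotS k) /=.
by rewrite -!addnA; congr (_ + (_ + _)); rewrite addnC.
Qed.

Lemma size_level_children (X : eqType) (ch : X -> seq X) k s :
  size (level ch k s) = \sum_(x <- s) size (level ch k [:: x]).
Proof. by rewrite level_flatten size_flatten /shape sumnE !big_map. Qed.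

Lemma size_node_level k n : size (level node_children k [:: n]) = ballot k (node_label n).
Proof.
elim: k n => // k IH [[[[p M] s] t] f].
rewrite levelSr (_ : flatten _ = node_children (p, M, s, t, f)); last by rewrite /= cats0.
have sum_cat (r1 r2 : seq node) F :
  \sum_(x <- r1 ++ r2) F x = \sum_(x <- r1) F x + \sum_(x <- r2) F x by exact: big_cat.
rewrite size_level_children /node_children !sum_cat !big_map.
have -> : \sum_(i <- iota 0 (size s).+1)
    size (level node_children k [:: (p ++ M :: take i s, M.+1, drop i s, t, true)]) =
  \sum_(i < (size s).+1) ballot k i.*2.+2.
  rewrite -[in iota _ _](subn0 (size s).+1) -/(index_iota _ _) big_mkord.
  rewrite [RHS](reindex_inj rev_ord_inj); apply: eq_bigr => i _.
  by rewrite IH /= size_drop subSS.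
have -> : \sum_(i <- iota 1 (size s))
    size (level node_children k [:: (p, M, take i s, M :: drop i s ++ t, false)]) =
  \sum_(i < size s) ballot k i.*2.+3.
  have -> : iota 1 (size s) = index_iota 1 (size s).+1 by rewrite /index_iota subn1.
  rewrite big_add1 big_mkord.
  by apply: eq_bigr => i _; rewrite IH /= size_takel.
(* If [M] occurs once, the adjacent copy contributes the additional label [2a + 3] with
   [a = size s]. *)
rewrite addnA sum_ballot_children; case: f; rewrite ?big_seq1 ?big_nil ?addn0 //.
by rewrite IH /node_label -[size (M :: s)]/(size s).+1 doubleS (ballotS k (size s).*2.+1).
Qed.

Definition trig_pair := [:: [:: 0; 0; 0; 1]; [:: 1; 0; 1; 2]].

Lemma S_n_trig_pair k : S_n trig_pair k.+1 = catalan k.+1.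
Proof.
rewrite -ballot_catalan -[2]/(node_label node_root) -size_node_level -(size_map node_word).
apply: S_n_eq_size.
  rewrite map_inj_in_uniq ?uniq_node_level // => m n.
  by move=> /mem_node_level[im _] /mem_node_level[jn _]; apply: node_word_inj.
move=> w; rewrite -/(good w) ascent_good; apply/mapP/andP => [[n /mem_node_level[ni szn] ->]|[]].
  by rewrite szn eqxx; case: n ni {szn} => [[[[p M] s] t] f] [].
move=> /eqP szw gw; have w0 : w != [::] by case: (w) szw.
have [n ni nE] := node_of_word w0 gw.
by exists n => //; apply/mem_node_level; rewrite nE.
Qed.

(** * From generating trees to the counts of the theorem *)

Section AppendClass.
Variables (T : seq (seq nat)) (allowed : seq nat -> seq nat).
Let K w := is_ascent_seq w && avoids_all T w.
Hypothesis T1 : avoids_all T [:: 0].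
Hypothesis allowedE : forall w x, w != [::] -> K w -> (x \in allowed w) = K (rcons w x).
Hypothesis allowed_uniq : forall w, uniq (allowed w).

Lemma append_class_level k : let L := level (append_children allowed) k [:: [:: 0]] in
  uniq L /\ forall w, (w \in L) = [&& size w == k.+1, is_ascent_seq w & avoids_all T w].
Proof.
have K1 x : K [:: x] = (x == 0) by rewrite /K is_ascent_seq1; case: eqP => // ->.
have Kp w x : w != [::] -> K (rcons w x) -> K w.
  move=> w0 /andP[]; rewrite is_ascent_seq_rcons // => /andP[aw _] av.
  by rewrite /K aw; apply: avoids_all_subseq av; apply: subseq_rcons.
split; first by apply: (append_level_uniq K1 Kp allowedE).
exact: (mem_append_level K1 Kp allowedE).
Qed.

Lemma append_class_labels (Y : eqType) (lab : seq nat -> Y) (chY : Y -> seq Y) :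
  (forall w, w != [::] -> K w ->
    map lab (append_children allowed w) = chY (lab w)) ->
  forall k, map lab (level (append_children allowed) k [:: [:: 0]]) =
    level chY k [:: lab [:: 0]].
Proof.
move=> labE k; apply: (level_morph (P := fun w => (w != [::]) && K w)).
- by move=> w /andP[]; apply: labE.
- move=> w y /andP[w0 Kw] /mapP[x + ->]; rewrite allowedE // => ->.
  by case: (w).
by move=> w; rewrite inE => /eqP ->; rewrite /K T1.
Qed.

End AppendClass.

Lemma gap_pair1 b : avoids_all (gap_pair b) [:: 0].
Proof. by apply: contraT => /gap_pairP[a [c [z [_ /size_subseq]]]]. Qed.

Lemma S_n_gap_pair b k : S_n (gap_pair b) k.+1 = catalan k.+1.
Proof.
have uA w : uniq (gap_allowed b w) by rewrite filter_uniq ?iota_uniq.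
have [uL memL] := append_class_level (gap_pair1 b) (@gap_allowedE b) uA k.
rewrite (S_n_eq_size uL memL) -(size_map (gap_label_of b)).
rewrite (append_class_labels (gap_pair1 b) (@gap_allowedE b) (@gap_labels b)).
by rewrite -size_gap_level.
Qed.

Lemma S_n_sum T n (L : seq (seq nat)) : uniq L ->
  (forall w, (w \in L) = [&& size w == n, is_ascent_seq w & avoids_all T w]) ->
  0 < n -> S_n T n = \sum_(m < n) S_nm T n m.
Proof.
move=> uL memL n0; rewrite (S_n_eq_size uL memL).
under [RHS]eq_bigr do rewrite (S_nm_eq_count _ uL memL) -sum1_count big_mkcond.
rewrite exchange_big -sum1_size; apply: eq_big_seq => w.
rewrite memL => /andP[/eqP szw _].
have wn : asc w < n by rewrite -szw asc_lt_size // -size_eq0 szw -lt0n.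
by rewrite (bigD1 (Ordinal wn)) //= eqxx big1 // => m; rewrite -val_eqE eq_sym /= => /negbTE ->.
Qed.

Section NarayanaClass.
Variables (T : seq (seq nat)) (Q : pred (seq nat)) (allowed : seq nat -> seq nat).
Hypothesis avoidsE : forall w, is_ascent_seq w -> avoids_all T w = Q w.
Hypothesis Q1 : Q [:: 0].
Hypothesis allowedE : forall w x, w != [::] -> is_ascent_seq w && Q w ->
  (x \in allowed w) = is_ascent_seq (rcons w x) && Q (rcons w x).
Hypothesis allowed_uniq : forall w, uniq (allowed w).
Hypothesis labels : forall w, w != [::] -> is_ascent_seq w && Q w ->
  map nar_label_of (append_children allowed w) = nar_children (nar_label_of w).

Import GRing.Theory.
Local Open Scope ring_scope.

Lemma narayana_class k : S_n T k.+1 = catalan k.+1 /\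
  forall m, (m <= k)%N -> S_nm T k.+1 m = narayana k.+1 m.+1.
Proof.
have avE w : is_ascent_seq w && avoids_all T w = is_ascent_seq w && Q w.
  by case: (boolP (is_ascent_seq w)) => // /avoidsE.
have T1 : avoids_all T [:: 0%N] by rewrite avoidsE.
have alE w x : w != [::] -> is_ascent_seq w && avoids_all T w ->
    (x \in allowed w) = is_ascent_seq (rcons w x) && avoids_all T (rcons w x).
  by rewrite !avE; apply: allowedE.
have labE w : w != [::] -> is_ascent_seq w && avoids_all T w ->
    map nar_label_of (append_children allowed w) = nar_children (nar_label_of w).
  by rewrite avE; apply: labels.
have [uL memL] := append_class_level T1 alE allowed_uniq k.
suff S_nmE m : (m <= k)%N -> S_nm T k.+1 m = narayana k.+1 m.+1.
  split=> //; rewrite (S_n_sum uL memL) // -sum_narayana.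
  by apply: eq_bigr => m _; rewrite S_nmE // -ltnS.
move=> mk; rewrite (S_nm_eq_count _ uL memL).
have -> : count (fun w => asc w == m) (level (append_children allowed) k [:: [:: 0%N]]) =
    count (fun l : nar_label => l.2 == m) (level nar_children k [:: (false, 0%N, 0%N)]).
  by rewrite -[(false, _, _)]/(nar_label_of [:: 0%N]) -(append_class_labels T1 alE labE) count_map.
(* The nodes with [m] ascents are counted by the coefficient of ['X^m] in the generating polynomial
   of generation [k]. *)
have := congr1 (fun q : {poly int} => q`_m) (sum_nar_level k false 0 0).
rewrite expr0 mul1r coef_sum /nar_poly addr0 /= addn0 coef_motzkin_poly addn0.
under eq_bigr do rewrite coefXn.
(* By the determinant form, the product subtracted in the reflection formula cancels and the
   Narayana number remains. *)
rewrite -(narayanaE mk) natrD addrC addKr -natr_sum => /eqP.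
rewrite Num.Theory.eqr_nat => /eqP <-; rewrite -sum1_count big_mkcond.
by apply: eq_bigr => l _; rewrite eq_sym; case: eqP.
Qed.

End NarayanaClass.

Lemma pos_incr_class T : (forall w, is_ascent_seq w -> avoids_all T w = pos_incr w) ->
  forall k, S_n T k.+1 = catalan k.+1 /\
    forall m, m <= k -> S_nm T k.+1 m = narayana k.+1 m.+1.
Proof.
move=> avE; apply: (narayana_class avE) => //.
- exact: pos_incr_allowedE.
- exact: pos_incr_allowed_uniq.
exact: pos_incr_labels.
Qed.

Lemma gt1_strict_class T : (forall w, is_ascent_seq w -> avoids_all T w = gt1_strict w) ->
  forall k, S_n T k.+1 = catalan k.+1 /\
    forall m, m <= k -> S_nm T k.+1 m = narayana k.+1 m.+1.
Proof.
move=> avE; apply: (narayana_class avE) => //.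
- exact: gt1_strict_allowedE.
- exact: gt1_strict_allowed_uniq.
exact: gt1_strict_labels.
Qed.

Lemma narayana_pairs u v : (u, v) \in [:: ([:: 0; 0; 2; 1], [:: 0; 1; 2; 1]);
    ([:: 0; 1; 2; 1], [:: 0; 1; 3; 2]); ([:: 0; 1; 2; 1], [:: 1; 0; 3; 2]);
    ([:: 0; 1; 2; 2], [:: 0; 1; 3; 2]); ([:: 0; 1; 2; 2], [:: 1; 0; 3; 2])] ->
  forall k, S_n [:: u; v] k.+1 = catalan k.+1 /\
    forall m, m <= k -> S_nm [:: u; v] k.+1 m = narayana k.+1 m.+1.
Proof.
rewrite !inE => /or4P[/eqP[-> ->]|/eqP[-> ->]|/eqP[-> ->]|/orP[/eqP[-> ->]|/eqP[-> ->]]].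
- exact: pos_incr_class avoids_0021_0121.
- exact: pos_incr_class avoids_0121_0132.
- exact: pos_incr_class avoids_0121_1032.
- exact: gt1_strict_class avoids_0122_0132.
exact: gt1_strict_class avoids_0122_1032.
Qed.

Theorem theorem1 :
  (forall u v : seq nat,
     (u, v) \in [:: ([:: 0; 0; 0; 1], [:: 1; 0; 1; 2]);
                   ([:: 0; 0; 1; 0], [:: 0; 0; 2; 1]);
                   ([:: 0; 0; 1; 1], [:: 0; 0; 2; 1]);
                   ([:: 0; 0; 2; 1], [:: 0; 1; 2; 1]);
                   ([:: 0; 1; 2; 1], [:: 0; 1; 3; 2]);
                   ([:: 0; 1; 2; 1], [:: 1; 0; 3; 2]);
                   ([:: 0; 1; 2; 2], [:: 0; 1; 3; 2]);
                   ([:: 0; 1; 2; 2], [:: 1; 0; 3; 2])] ->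
     forall n : nat, 1 <= n -> S_n [:: u; v] n = catalan n)
  /\
  (forall u v : seq nat,
     (u, v) \in [:: ([:: 0; 0; 2; 1], [:: 0; 1; 2; 1]);
                   ([:: 0; 1; 2; 1], [:: 0; 1; 3; 2]);
                   ([:: 0; 1; 2; 1], [:: 1; 0; 3; 2]);
                   ([:: 0; 1; 2; 2], [:: 0; 1; 3; 2]);
                   ([:: 0; 1; 2; 2], [:: 1; 0; 3; 2])] ->
     forall n m : nat, 1 <= n -> m < n -> S_nm [:: u; v] n m = narayana n m.+1).
Proof.
split=> u v uv [//|k]; last by move=> m _ mk; apply: (narayana_pairs uv k).2.
move=> _; move: uv; rewrite !in_cons.
case/or4P=> [/eqP[-> ->]|/eqP[-> ->]|/eqP[-> ->]|uv].
- exact: S_n_trig_pair.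
- exact: (S_n_gap_pair true).
- exact: (S_n_gap_pair false).
by apply: (narayana_pairs _ k).1; rewrite !in_cons.
Qed.
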